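(* Let $(u,v,g,h)$ be the unique global solution of the free boundary problem (FBP) described in the context, and suppose that $\lim_{t\to\infty}g(t)=-\infty$ and $\lim_{t\to\infty}h(t)=\infty$ (spreading happens). (i) In the weak competition case, i.e. $f_1(u,v)=u(a-u-bv)$, $f_2(u,v)=v(1-v-cu)$ with $1/c>a>b$, one has $$\lim_{t\to\infty}(u(t,x),v(t,x))=\left(\frac{a-b}{1-bc},\ \frac{1-ac}{1-bc}\right)\quad\text{locally uniformly for }x\in\mathbb R.$$ (ii) In the weak predation case, i.e. $f_1(u,v)=u(a-u-bv)$, $f_2(u,v)=v(1-v+cu)$ with $a>b+abc$, one has $$\lim_{t\to\infty}(u(t,x),v(t,x))=\left(\frac{a-b}{1+bc},\ \frac{1+ac}{1+bc}\right)\quad\text{locally uniformly for }x\in\mathbb R.$$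
   Context: Parameters: $d_1,d_2,\mu,\rho,h_0,a,b,c$ are positive constants. The kernel $J:\mathbb R\to\mathbb R$ is Lipschitz continuous, $J(0)>0$, $J(x)\ge 0$ for all $x$, $\int_{\mathbb R}J(x)\,dx=1$, $J$ is symmetric ($J(x)=J(-x)$), and $\sup_{\mathbb R}J<\infty$. Initial data: $u_0$ is Lipschitz continuous on $[-h_0,h_0]$, $v_0\in W^2_p(-h_0,h_0)$ with $p>3$, $u_0(\pm h_0)=v_0(\pm h_0)=0$, and $u_0>0$, $v_0>0$ in $(-h_0,h_0)$. The problem (FBP), with unknowns $(u,v,g,h)$ and reaction terms $(f_1,f_2)$ as given in the respective cases of the claim: $$\left\{\begin{aligned} &u_t=d_1\int_{g(t)}^{h(t)}J(x-y)u(t,y)\,dy-d_1u+f_1(u,v), && t>0,\ g(t)<x<h(t),\\ &v_t=d_2v_{xx}+f_2(u,v), && t>0,\ g(t)<x<h(t),\\ &u(t,g(t))=u(t,h(t))=v(t,g(t))=v(t,h(t))=0, && t\ge0,\\ &h'(t)=-\mu v_x(t,h(t))+\rho\int_{g(t)}^{h(t)}\int_{h(t)}^{\infty}J(x-y)u(t,x)\,dy\,dx, && t\ge0,\\ &g'(t)=-\mu v_x(t,g(t))-\rho\int_{g(t)}^{h(t)}\int_{-\infty}^{g(t)}J(x-y)u(t,x)\,dy\,dx, && t\ge0,\\ &u(0,x)=u_0(x),\ v(0,x)=v_0(x), && -h_0<x<h_0,\\ &h(0)=-g(0)=h_0. \end{aligned}\right.$$ The functions $u(t,\cdot)$, $v(t,\cdot)$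 are taken to be identically $0$ outside $[g(t),h(t)]$. It is known that (FBP) has a unique global solution, and that it satisfies, for $t>0$ and $g(t)<x<h(t)$, $0<u\le k_1$, $0<v\le k_2$, and $g'(t)<0<h'(t)$, $0<-v_x(t,h(t))\le k_3$, $0<v_x(t,g(t))\le k_3$ for some constants $k_1,k_2,k_3$. For some $\alpha\in(0,1)$ and all $0<\tau<T<\infty$: $g,h\in C^{1+\alpha/2}([0,T])$; $u$ is continuously differentiable in $t$ and Lipschitz in $x$ on $\{0\le t\le T,\ g(t)\le x\le h(t)\}$; $v\in C^{1+\alpha/2,2+\alpha}$ on $\{\tau\le t\le T,\ g(t)\le x\le h(t)\}$; and $v,v_x$ are continuous up to $t=0$. *)

(* Defs.v *)
From HB Require Import structures.
From mathcomp Require Import all_boot all_order all_algebra.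
From mathcomp Require Import all_classical all_reals all_analysis.
Set Implicit Arguments.
Unset Strict Implicit.
Unset Printing Implicit Defensive.
Import Order.TTheory GRing.Theory Num.Theory.
Import numFieldNormedType.Exports.
Local Open Scope classical_set_scope.
Local Open Scope ring_scope.

Local Notation leb := lebesgue_measure.

(* Derivative of f at x relative to a set A of admissible points: two-sided at
   interior points of A, one-sided at end points. *)
Definition derivable_in (R : realType) (A : set R) (f : R -> R) (x : R) : Prop :=
  cvg ((f y - f x) / (y - x) @[y --> within A x^']).

Definition derive_in (R : realType) (A : set R) (f : R -> R) (x : R) : R :=
  lim ((f y - f x) / (y - x) @[y --> within A x^']).

Record dispersal_kernel (R : realType) (J : R -> R) : Prop := {
  kernel_lipschitz : [lipschitz J x | x in [set: R]];
  kernel_gt0_at0 : 0 < J 0;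
  kernel_ge0 : forall x : R, 0 <= J x;
  kernel_mass1 : (\int[leb]_x (J x)%:E = 1)%E;
  kernel_sym : forall x : R, J x = J (- x);
  kernel_bounded : has_ubound (range J)
}.

Definition test_function (R : realType) (A : set R) (phi : R -> R) : Prop :=
  (forall n x, derivable (derive1n n phi) x 1) /\
  exists2 K : set R, compact K /\ K `<=` A & forall x, ~ K x -> phi x = 0.

Definition weak_derivative (R : realType) (A : set R) (n : nat) (f w : R -> R)
    : Prop :=
  forall phi : R -> R, test_function A phi ->
    \int[leb]_(x in A) (f x * derive1n n phi x) =
    (-1) ^+ n * \int[leb]_(x in A) (w x * phi x).

(* L^p(A), through the extension by zero to the whole line. *)
Definition Lp_on (R : realType) (A : set R) (p : R) (f : R -> R) : Prop :=
  f \_ A \in Lfun leb p%:E.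

Definition W2p (R : realType) (A : set R) (p : R) (f : R -> R) : Prop :=
  Lp_on A p f /\
  forall n, (1 <= n <= 2)%N ->
    exists2 w : R -> R, Lp_on A p w & weak_derivative A n f w.

(* W2p does not see null sets; since v0 is prescribed pointwise at the end
   points, v0 is taken to be the continuous representative. *)
Record initial_data (R : realType) (h0 p : R) (u0 v0 : R -> R) : Prop := {
  u0_lipschitz : [lipschitz u0 x | x in `[- h0, h0]];
  v0_W2p : W2p `]- h0, h0[ p v0;
  v0_continuous : {within `[- h0, h0], continuous v0};
  u0_bnd : u0 (- h0) = 0 /\ u0 h0 = 0;
  v0_bnd : v0 (- h0) = 0 /\ v0 h0 = 0;
  u0_gt0 : forall x : R, - h0 < x < h0 -> 0 < u0 x;
  v0_gt0 : forall x : R, - h0 < x < h0 -> 0 < v0 x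
}.

(* The moving domain {(t, x) | t >= 0, g t <= x <= h t}; functions of (t, x)
   are differentiated relative to it, so that v_x at a free boundary and time
   derivatives at t = 0 are one-sided. *)

Definition moving_domain (R : realType) (g h : R -> R) : set (R * R) :=
  [set z | 0 <= z.1 /\ g z.1 <= z.2 <= h z.1].

Definition moving_domain_slab (R : realType) (g h : R -> R) (tau T : R)
    : set (R * R) :=
  [set z | tau <= z.1 <= T /\ g z.1 <= z.2 <= h z.1].

Definition time_section (R : realType) (g h : R -> R) (x : R) : set R :=
  [set t | moving_domain g h (t, x)].

Definition space_section (R : realType) (g h : R -> R) (t : R) : set R :=
  `[g t, h t].

Definition pdt (R : realType) (g h : R -> R) (w : R -> R -> R) (t x : R) : R :=
  derive_in (time_section g h x) (w ^~ x) t.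

Definition pdx (R : realType) (g h : R -> R) (w : R -> R -> R) (t x : R) : R :=
  derive_in (space_section g h t) (w t) x.

Definition pdxx (R : realType) (g h : R -> R) (w : R -> R -> R) : R -> R -> R :=
  pdx g h (pdx g h w).

Definition ddt (R : realType) (f : R -> R) (t : R) : R :=
  derive_in `[0, +oo[ f t.

Record FBP_equations (R : realType) (d1 d2 mu rho h0 : R) (J : R -> R)
    (u0 v0 : R -> R) (f1 f2 : R -> R -> R) (u v : R -> R -> R) (g h : R -> R)
    : Prop := {
  FBP_u : forall t x : R, 0 < t -> g t < x < h t ->
    pdt g h u t x = d1 * (\int[leb]_(y in `[g t, h t]) (J (x - y) * u t y))
                    - d1 * u t x + f1 (u t x) (v t x);
  FBP_v : forall t x : R, 0 < t -> g t < x < h t ->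
    pdt g h v t x = d2 * pdxx g h v t x + f2 (u t x) (v t x);
  FBP_bnd : forall t : R, 0 <= t ->
    [/\ u t (g t) = 0, u t (h t) = 0, v t (g t) = 0 & v t (h t) = 0];
  FBP_h : forall t : R, 0 <= t ->
    ddt h t = - mu * pdx g h v t (h t)
      + rho * \int[leb]_(x in `[g t, h t])
                (\int[leb]_(y in `[h t, +oo[) (J (x - y) * u t x));
  FBP_g : forall t : R, 0 <= t ->
    ddt g t = - mu * pdx g h v t (g t)
      - rho * \int[leb]_(x in `[g t, h t])
                (\int[leb]_(y in `]-oo, g t]) (J (x - y) * u t x));
  FBP_init : forall x : R, - h0 < x < h0 -> u 0 x = u0 x /\ v 0 x = v0 x;
  FBP_init_bnd : h 0 = h0 /\ g 0 = - h0;
  FBP_outside : forall t x : R, 0 <= t -> ~ (g t <= x <= h t) ->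
    u t x = 0 /\ v t x = 0
}.

Definition C1_holder (R : realType) (e T : R) (f : R -> R) : Prop :=
  (forall t : R, 0 <= t <= T -> derivable_in `[0, +oo[ f t) /\
  exists C : R, forall s t : R, 0 <= s <= T -> 0 <= t <= T ->
    `|ddt f s - ddt f t| <= C * `|s - t| `^ e.

Definition parabolic_holder (R : realType) (Q : set (R * R)) (alpha : R)
    (w : R -> R -> R) : Prop :=
  exists C : R, forall s x t y : R, Q (s, x) -> Q (t, y) ->
    `|w s x - w t y| <= C * (`|s - t| `^ (alpha / 2) + `|x - y| `^ alpha).

(* v is in C^{1+alpha/2, 2+alpha} of the slab tau <= t <= T: besides v_t and
   v_xx, the usual norm of this space controls the (1+alpha)/2-Hoelder seminorm
   of v_x in time. *)
Record C_parabolic (R : realType) (g h : R -> R) (alpha tau T : R)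
    (v : R -> R -> R) : Prop := {
  Cpar_dt : forall t x : R, moving_domain_slab g h tau T (t, x) ->
    derivable_in (time_section g h x) (v ^~ x) t;
  Cpar_dx : forall t x : R, moving_domain_slab g h tau T (t, x) ->
    derivable_in (space_section g h t) (v t) x;
  Cpar_dxx : forall t x : R, moving_domain_slab g h tau T (t, x) ->
    derivable_in (space_section g h t) (pdx g h v t) x;
  Cpar_dt_holder : parabolic_holder (moving_domain_slab g h tau T) alpha
    (pdt g h v);
  Cpar_dxx_holder : parabolic_holder (moving_domain_slab g h tau T) alpha
    (pdxx g h v);
  Cpar_dx_holder : exists C : R, forall s t x,
    moving_domain_slab g h tau T (s, x) ->
    moving_domain_slab g h tau T (t, x) ->
    `|pdx g h v s x - pdx g h v t x| <= C * `|s - t| `^ ((1 + alpha) / 2)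
}.

Record FBP_regularity (R : realType) (u v : R -> R -> R) (g h : R -> R)
    : Prop := {
  reg_u_dt : forall t x : R, moving_domain g h (t, x) ->
    derivable_in (time_section g h x) (u ^~ x) t;
  reg_u_dt_continuous :
    {within moving_domain g h, continuous (fun z => pdt g h u z.1 z.2)};
  reg_u_lipschitz : forall T : R, 0 < T ->
    exists L : R, forall t : R, 0 <= t <= T -> L.-lipschitz_`[g t, h t] (u t);
  reg_v_continuous :
    {within moving_domain g h, continuous (fun z => v z.1 z.2)};
  reg_v_dx : forall t x : R, moving_domain g h (t, x) ->
    derivable_in (space_section g h t) (v t) x;
  reg_v_dx_continuous :
    {within moving_domain g h, continuous (fun z => pdx g h v z.1 z.2)};
  reg_holder : exists2 alpha : R, 0 < alpha < 1 &
    forall tau T : R, 0 < tau < T ->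
      [/\ C1_holder (alpha / 2) T g, C1_holder (alpha / 2) T h
        & C_parabolic g h alpha tau T v]
}.

(* Positivity, boundedness and monotone fronts: established properties of the
   unique global solution, carried along with it. *)
Definition FBP_bounds (R : realType) (u v : R -> R -> R) (g h : R -> R) : Prop :=
  exists k1 k2 k3 : R, forall t : R, 0 < t ->
    [/\ forall x : R, g t < x < h t -> 0 < u t x <= k1 /\ 0 < v t x <= k2,
        ddt g t < 0 < ddt h t,
        0 < - pdx g h v t (h t) <= k3
      & 0 < pdx g h v t (g t) <= k3].

Definition FBP_global_solution (R : realType) (d1 d2 mu rho h0 : R)
    (J u0 v0 : R -> R) (f1 f2 : R -> R -> R) (u v : R -> R -> R) (g h : R -> R)
    : Prop :=
  [/\ FBP_equations d1 d2 mu rho h0 J u0 v0 f1 f2 u v g h,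
      FBP_regularity u v g h
    & FBP_bounds u v g h].

(* As R is locally compact, locally uniform convergence in x is uniform
   convergence on compact sets. *)
Definition cvg_locally_uniformly (R : realType) (u v : R -> R -> R) (U V : R)
    : Prop :=
  forall K : set R, compact K ->
    {uniform K, (fun t x => (u t x, v t x)) @ +oo --> (fun=> (U, V))}.

(* Main.v *)
Require Import Defs.
From HB Require Import structures.
From mathcomp Require Import all_boot all_order all_algebra.
From mathcomp Require Import all_classical all_reals all_analysis.
From mathcomp Require Import measurable_realfun ring lra.
Set Implicit Arguments.
Unset Strict Implicit.
Unset Printing Implicit Defensive.
Import Order.TTheory GRing.Theory Num.Theory.
Import numFieldNormedType.Exports.
Local Open Scope classical_set_scope.
Local Open Scope ring_scope.

(** Write phi for the cosine arch cos (pi x / (2 L)) on [-L, L] and omega for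
its frequency pi / (2 L), which is small when L is large.  The arch almost
annihilates both diffusion operators: phi'' = - omega^2 phi, and, extended by
zero, (J * phi)(x) >= (1 - k) phi(x) on [-L, L] with k -> 0 as L -> oo
([kernel_arch]).  So arches can serve as spatial profiles of barriers both for
the nonlocal u-equation and for the local v-equation, at the price of an
arbitrarily small error.

Each component solves w_t = D w + w (r - w), where D is one of the two
diffusion operators and the growth rate r is affine in the other component.
From below, compare w with s(t) phi(x): at a first contact time the diffusion
costs at most k w, so as long as s < r - k the function s can be pushed up, and
it stops only when it reaches liminf r.  From above, compare w + K phi with
s(t), where K bounds w: at a first contact the diffusion gains at most k, and s
can be pushed down to K + limsup r.  Since phi is close to 1 on a fixed compact
set when L is large, this yields, locally uniformly in x,
liminf r <= liminf w if liminf r > 0 ([liminf_ge_logistic]) and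
limsup w <= limsup r if limsup r >= 0 ([limsup_le_logistic]).  Spreading enters
here only: it makes every window [-L, L] lie inside the habitat from some time
on.

The two implications turn a bound on one component into a bound on the other.
Going once around the loop (in the predation case twice, because there an upper
bound on u yields an upper bound on v and then a lower one on u) maps an upper
bound A to q + k A with 0 <= k < 1.  The infimum of all upper bounds is
therefore at most the fixed point q / (1 - k) ([limsup_le_contraction]), which is
the coexistence state; the matching lower bounds follow. *)

(** * One-variable calculus *)

Lemma within_filterE (T : Type) (F : set_system T) {FF : Filter F} (A : set T) :
  F A -> within A F = F.
Proof.
move=> FA; apply/funext => P; apply/propext; rewrite /within /=; split.
  by move=> AP; apply: filterS2 AP FA => y Py Ay; exact: Py.
by apply: filterS => y Py _.
Qed.

Lemma derive_in_interior (R : realType) (A : set R) (f : R -> R) (x : R) :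
  nbhs x A -> derivable_in A f x -> is_derive x 1 f (derive_in A f x).
Proof.
move=> xA; rewrite /derivable_in /derive_in.
rewrite (within_filterE (nbhs_dnbhs xA)).
set l := lim _ => cf.
have key : (h^-1 *: (f (h *: 1 + x) - f x)) @[h --> 0^'] --> l.
  apply/cvgrPdist_lt => e e0.
  have /cvgrPdist_lt /(_ e e0) [d /= d0 xd] := cf.
  exists d => //= h /= hd h0.
  have := xd (h + x); rewrite /= addrK [_%:A]mulr1 => xdh.
  rewrite -[_ *: _]mulrC; apply: xdh.
    by move: hd; rewrite sub0r opprD addrC subrK.
  by apply/eqP => hx; move/eqP: h0; apply; rewrite -[h](addrK x) hx subrr.
split; first by apply: cvgP key.
exact: cvg_lim key.
Qed.

(** The one-sided bound suffices because the two-sided derivative is also the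
limit of the left difference quotients.  The left side is the one available at
a first contact time. *)
Lemma derive1_le_left (R : realType) (f : R -> R) (T t l k : R) :
  T < t -> is_derive t 1 f l ->
  (forall s, T <= s -> s < t -> f t - f s <= k * (t - s)) -> l <= k.
Proof.
move=> Tt [df dfl] fk.
have /cvg_dnbhs_at_left lf : (h^-1 *: (f (h *: 1 + t) - f t)) @[h --> 0^'] -->
    l by rewrite -dfl; exact: df.
apply: (cvgr_to_le lf).
near=> h.
have h0 : h < 0 by near: h; exact: nbhs_left_lt.
have Th : T - t < h by near: h; apply: nbhs_left_gt; rewrite subr_lt0.
rewrite [_%:A]mulr1.
have /fk : T <= h + t by rewrite ltW// -ltrBlDr.
rewrite gtrDr => /(_ h0) {}fk.
rewrite [_ *: _]mulrC ler_ndivrMr//.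
by rewrite -lerN2 opprB (le_trans fk)// opprD addrCA subrr addr0 mulrN.
Unshelve. all: by end_near. Qed.

Lemma derive1_ge_left (R : realType) (f : R -> R) (T t l k : R) :
  T < t -> is_derive t 1 f l ->
  (forall s, T <= s -> s < t -> k * (t - s) <= f t - f s) -> k <= l.
Proof.
move=> Tt df fk; rewrite -lerN2.
apply: (derive1_le_left Tt (is_deriveN df)) => s Ts st.
by rewrite !fctE -opprD mulNr lerN2 fk.
Qed.

(** If ddf were negative, df, which vanishes at c, would be negative just to
the right of c, and f would decrease there. *)
Lemma second_derivative_test (R : realType) (f df : R -> R) (a b c ddf : R) :
  c \in `]a, b[ ->
  (forall x, x \in `]a, b[ -> is_derive x 1 f (df x)) ->
  is_derive c 1 df ddf ->
  (forall x, x \in `]a, b[ -> f c <= f x) -> 0 <= ddf.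
Proof.
move=> cab fdf dfc fmin.
have ab : a <= b by rewrite ltW// (itvP cab).
have f_ex x : x \in `]a, b[ -> derivable f x 1 by move=> /fdf[].
have df0 : df c = 0.
  have [_ <-] := fdf c cab.
  by have [_ ->] := derive1_at_min ab f_ex cab fmin.
rewrite leNgt; apply/negP => ddf0.
have [dfd dfE] := dfc.
have lf : (h^-1 *: (df (h *: 1 + c) - df c)) @[h --> 0^'+] --> ddf.
  by apply: cvg_dnbhs_at_right; rewrite -dfE; exact: dfd.
have := cvgr_lt _ lf _ ddf0.
move=> [e /= e0 He].
pose d := Num.min (e / 2) ((b - c) / 2).
have d0 : 0 < d by rewrite lt_min !divr_gt0//= subr_gt0 (itvP cab).
have de : d < e by rewrite gt_min ltr_pdivrMr// ltr_pMr// ltr1n.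
have dbc : c + d < b.
  rewrite -ltrBrDl gt_min; apply/orP; right.
  by rewrite ltr_pdivrMr// ltr_pMr ?ltr1n// subr_gt0 (itvP cab).
have incl x : x \in `[c, c + d] -> x \in `]a, b[.
  move=> xcd; rewrite in_itv/= (lt_le_trans _ (_ : c <= x)) ?(itvP cab)//=.
    by rewrite (le_lt_trans _ dbc)// (itvP xcd).
  by rewrite (itvP xcd).
have fcont : {within `[c, c + d], continuous f}.
  by apply: derivable_within_continuous => x /incl xab; exact: f_ex.
have fdf' x : x \in `]c, c + d[ -> is_derive x 1 f (df x).
  by move=> xcd; apply: fdf; apply: incl; exact: subset_itv_oo_cc.
have cd : c < c + d by rewrite ltrDl.
have [x xcd fcd] := MVT cd fdf' fcont.
have xd : 0 < x - c by rewrite subr_gt0 (itvP xcd).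
have := He (x - c); rewrite /= sub0r normrN gtr0_norm// [_%:A]mulr1 subrK df0 subr0.
rewrite (lt_trans _ de) ?ltrBlDl ?(itvP xcd)// => /(_ isT xd).
rewrite pmulr_rlt0 ?invr_gt0// => dfx0.
move: fcd; rewrite [c + d - c]addrAC subrr add0r => fcd.
have : f (c + d) < f c by rewrite -subr_lt0 fcd nmulr_rlt0.
by rewrite ltNge fmin// incl// in_itv/= lexx andbT lerDl ltW.
Qed.

(** * First contact *)

(** The points of [T, t1] x [-L, L] where f is nonpositive form a compact set;
one with the least time coordinate is a first contact.  There f vanishes, since
it is nonnegative as a limit of earlier positive values. *)
Lemma first_touching (R : realType) (f : R -> R -> R) (T L : R) :
  (forall t x, T <= t -> `|x| <= L ->
    {for (t, x), continuous (fun z => f z.1 z.2)}) ->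
  (forall x, `|x| <= L -> 0 < f T x) ->
  (forall t x, T < t -> `|x| <= L -> f t x = 0 ->
    (forall y, `|y| <= L -> 0 <= f t y) ->
    (forall s, T <= s -> s < t -> 0 < f s x) -> False) ->
  forall t x, T <= t -> `|x| <= L -> 0 < f t x.
Proof.
move=> fc fT ftouch t1 x1 Tt1 x1L; rewrite ltNge; apply/negP => f1.
pose K : set (R * R) := `[T, t1] `*` `[- L, L].
have KE t x : K (t, x) = (T <= t <= t1 /\ `|x| <= L).
  by rewrite /K /setX /= !in_itv/= ler_norml.
have Kc : compact K by apply: compact_setX; exact: segment_compact.
have fK : {within K, continuous (fun z => f z.1 z.2)}.
  apply: continuous_in_subspaceT => -[t x]; rewrite inE KE => -[/andP[Tt _] xL].
  exact: fc.
have /closed_subspaceP[V Vc VK] := (continuous_closedP _).1 fK _ (@closed_le R 0).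
have KV z : (V `&` K) z <-> K z /\ f z.1 z.2 <= 0.
  by rewrite VK /= /setI /preimage /=; split=> -[].
have CV : compact (K `&` V) by exact: compact_closedI.
have [||[t x] /set_mem [Ktx Vtx] tmin] := @compact_EVT_min _ _ fst _ _ CV.
- by exists (t1, x1); rewrite setIC; apply/KV; rewrite KE Tt1 lexx.
- by apply: continuous_subspaceT => z; exact: cvg_fst.
have [_ ftx] : K (t, x) /\ f t x <= 0 by apply/(KV (t, x)).
move: (Ktx); rewrite KE => -[/andP[Tt tt1] xL].
have {}Tt : T < t.
  rewrite lt_neqAle Tt andbT; apply: contraTneq ftx => <-.
  by rewrite -ltNge fT.
have before s y : T <= s -> s < t -> `|y| <= L -> 0 < f s y.
  move=> Ts st yL; rewrite ltNge; apply/negP => fsy.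
  have : (s, y) \in K `&` V.
    rewrite inE setIC; apply/KV; rewrite KE Ts (le_trans (ltW st))//.
  by move=> /tmin /=; rewrite leNgt st.
have at_t y : `|y| <= L -> 0 <= f t y.
  move=> yL.
  have cy : f s y @[s --> t] --> f t y.
    apply: (@continuous_comp _ _ _ (fun s : R => (s, y)) (fun z => f z.1 z.2)).
      by apply: (@cvg_pair _ _ _ (nbhs t) (nbhs t) (nbhs y));
        [exact: cvg_id|exact: cvg_cst].
    exact: fc (ltW Tt) yL.
  apply: (cvgr_to_ge (cvg_at_left_filter cy)); near=> s; apply/ltW/before => //.
  by near: s; exact: nbhs_left_ge.
apply: (ftouch t x) => //; last by move=> s Ts st; exact: before.
by apply/eqP; rewrite eq_le ftx at_t.
Unshelve. all: by end_near. Qed.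

(** * The cosine arch *)

(** The arch is the restriction of this function to [-L, L].  Beyond, up to
distance 2 L, the cosine is nonpositive, hence it lies below the extension by
zero of the arch. *)
Definition arch (R : realType) (L x : R) : R := cos (pi / 2 * (x / L)).

Section arch.
Variables (R : realType) (L : R).
Hypothesis L0 : 0 < L.
Implicit Types x y : R.

Lemma arch_le1 x : arch L x <= 1.
Proof. exact: cos_le1. Qed.

Lemma archN x : arch L (- x) = arch L x.
Proof. by rewrite /arch mulNr mulrN cosN. Qed.

Lemma arch_abs x : arch L `|x| = arch L x.
Proof. by have [_|_] := ler0P x; rewrite ?archN. Qed.

Lemma arch_end x : `|x| = L -> arch L x = 0.
Proof. by move=> xL; rewrite -arch_abs xL /arch divff ?gt_eqF// mulr1 cos_pihalf. Qed.

Lemma arch_gt0 x : `|x| < L -> 0 < arch L x.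
Proof.
move=> xL; have pi20 : 0 < pi / 2 :> R by rewrite divr_gt0// pi_gt0.
rewrite -arch_abs; apply: cos_gt0_pihalf; apply/andP; split.
  apply: (@lt_le_trans _ _ 0); first by rewrite oppr_lt0.
  by apply: mulr_ge0; [exact: ltW|apply: divr_ge0; rewrite // ltW].
by rewrite gtr_pMr// ltr_pdivrMr// mul1r.
Qed.

Lemma arch_ge0 x : `|x| <= L -> 0 <= arch L x.
Proof.
by rewrite le_eqVlt => /orP[/eqP/arch_end->//|/arch_gt0/ltW].
Qed.

Lemma arch_le0 x : L <= `|x| <= L *+ 2 -> arch L x <= 0.
Proof.
move=> /andP[Lx xL]; rewrite -arch_abs -oppr_ge0.
have -> : - arch L `|x| = arch L (`|x| - L *+ 2).
  rewrite {2}/arch.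
  have -> : (`|x| - L *+ 2) / L = `|x| / L - 2 by field; rewrite gt_eqF.
  rewrite /arch mulrBr [pi / 2 * 2]divfK//.
  by rewrite -[in LHS](subrK (@pi R) (pi / 2 * _)) cosDpi opprK.
by apply: arch_ge0; rewrite ler_norml; lra.
Qed.

Lemma arch_sym x y : arch L (x + y) + arch L (x - y) = 2 * (arch L x * arch L y).
Proof.
rewrite /arch (mulrDl x y) (mulrBl _ x y) mulrDr mulrBr cosB cosD.
by rewrite addrACA addNr addr0 mulr_natl mulr2n.
Qed.

Lemma continuous_arch : continuous (arch L).
Proof.
move=> x; apply: (@continuous_comp _ _ _ (fun x => pi / 2 * (x / L)) (@cos R)).
  by apply: cvgM; [exact: cvg_cst|apply: cvgM; [exact: cvg_id|exact: cvg_cst]].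
exact: continuous_cos.
Qed.

End arch.

Lemma arch_near1 (R : realType) (M e : R) : 0 < e ->
  exists2 L0 : R, 0 < L0 & forall L x, L0 <= L -> `|x| <= M -> 1 - e <= arch L x.
Proof.
move=> e0.
have := @continuous_cos R 0; rewrite /continuous_at cos0 => /cvgrPdist_lt/(_ e e0).
move=> [d /= d0 Hd]; exists (pi / 2 * (`|M| + 1) / d).
  by rewrite divr_gt0// mulr_gt0 ?divr_gt0 ?pi_gt0// ltr_wpDl.
move=> L x; rewrite ler_pdivrMr// => LL xM.
have pi20 : 0 < pi / 2 :> R by rewrite divr_gt0// pi_gt0.
have M0 : 0 < `|M| + 1 by rewrite ltr_wpDl.
have L0 : 0 < L.
  by rewrite -(pmulr_lgt0 L d0); apply: lt_le_trans LL; rewrite mulr_gt0.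
have := Hd (pi / 2 * (x / L)); rewrite /= sub0r normrN normrM (gtr0_norm pi20).
rewrite normrM normfV (gtr0_norm L0) mulrA ltr_pdivrMr//.
rewrite (lt_le_trans (y := pi / 2 * (`|M| + 1))) ?[_ * L]mulrC//; last first.
  by rewrite ltr_pM2l// (le_lt_trans xM)// (le_lt_trans (ler_norm M))// ltrDl.
by move=> /(_ isT); rewrite ltr_norml => /andP[_]; rewrite /arch; lra.
Qed.

Definition arch_slope (R : realType) (L x : R) : R :=
  - (pi / 2 / L * sin (pi / 2 * (x / L))).

Lemma is_derive_arch (R : realType) (L x : R) :
  is_derive x 1 (arch L) (arch_slope L x).
Proof.
have E y : pi / 2 * (y / L) = pi / 2 / L * y by rewrite -mulrA [y / L]mulrC mulrA mulrA.
have -> : arch L = @cos R \o (fun y => (pi / 2 / L) *: (y : R)).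
  by apply/funext => y; rewrite /arch /= E.
apply: is_derive_eq; rewrite /arch_slope E /GRing.scale /=; ring.
Qed.

Lemma is_derive_arch_slope (R : realType) (L x : R) :
  is_derive x 1 (arch_slope L) (- (pi / 2 / L) ^+ 2 * arch L x).
Proof.
have E y : pi / 2 * (y / L) = pi / 2 / L * y by rewrite -mulrA [y / L]mulrC mulrA mulrA.
have -> : arch_slope L =
    (fun y => - (pi / 2 / L) *: y) \o @sin R \o (fun y => (pi / 2 / L) *: (y : R)).
  by apply/funext => y; rewrite /arch_slope /= E [_ *: _]mulNr.
apply: is_derive_eq; rewrite /arch E /GRing.scale /=; ring.
Qed.

(** Since pi / 2 / L <= 1 / (1 + 1 / q) <= 1 for L large, its square is at most
1 / (1 + 1 / q) <= q. *)
Lemma arch_frequency_small (R : realType) (q : R) : 0 < q ->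
  exists2 L0 : R, 0 < L0 & forall L, L0 <= L -> (pi / 2 / L) ^+ 2 <= q.
Proof.
move=> q0; have pi20 : 0 < pi / 2 :> R by rewrite divr_gt0// pi_gt0.
have q1 : 0 < 1 + q^-1 by rewrite addr_gt0// invr_gt0.
exists (pi / 2 * (1 + q^-1)); first by rewrite mulr_gt0.
move=> L LL; have L0 : 0 < L by apply: lt_le_trans LL; rewrite mulr_gt0.
set o := pi / 2 / L.
have o0 : 0 < o by rewrite divr_gt0.
have oq : o * (1 + q^-1) <= 1.
  by rewrite /o mulrAC ler_pdivrMr// mul1r.
have oi : 0 < o * q^-1 by rewrite mulr_gt0// invr_gt0.
have o1 : o <= 1 by lra.
have : o * q^-1 <= 1 by lra.
rewrite ler_pdivrMr// mul1r; apply: le_trans.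
by rewrite expr2 ler_piMl// ltW.
Qed.

(** * Integrals over intervals *)

Local Notation leb := lebesgue_measure.

(** Comparing the extensions by zero allows the two domains to differ. *)
Lemma le_Rintegral_patch (R : realType) (D1 D2 : set (measurableTypeR R))
    (f1 f2 : measurableTypeR R -> R) :
  measurable D1 -> measurable D2 ->
  leb.-integrable D1 (EFin \o f1) -> leb.-integrable D2 (EFin \o f2) ->
  (forall x, (f1 \_ D1) x <= (f2 \_ D2) x) ->
  \int[leb]_(x in D1) f1 x <= \int[leb]_(x in D2) f2 x.
Proof.
move=> mD1 mD2 if1 if2 f12.
have {}if1 := (integrable_mkcond _ mD1).1 if1.
have {}if2 := (integrable_mkcond _ mD2).1 if2.
rewrite Rintegral_mkcond [leRHS]Rintegral_mkcond.
by apply: le_Rintegral; rewrite -?restrict_EFin.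
Qed.

Lemma integrable_itv_continuous (R : realType) (a b : R) (f : R -> R) :
  {within `[a, b], continuous f} -> leb.-integrable `[a, b] (EFin \o f).
Proof.
by move=> cf; apply: continuous_compact_integrable => //; exact: segment_compact.
Qed.

Lemma Rintegral_translate (R : realType) (c a b : R) (f : R -> R) :
  a <= b -> continuous f ->
  \int[leb]_(x in `[c + a, c + b]) f x = \int[leb]_(x in `[a, b]) f (c + x).
Proof.
move=> ab cf; rewrite /Rintegral; congr fine.
have dF : (fun x => c + x)^`()%classic = cst (1 : R).
  apply/funext => x; rewrite derive1E.
  have [_ ->] := is_deriveD (is_derive_cst c x 1) (is_derive_id x (1 : R)).
  by rewrite add0r.
have Fc : continuous (fun x : R => c + x).
  by move=> x; apply: cvgD; [exact: cvg_cst|exact: cvg_id].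
rewrite (integration_by_substitution_increasing (F := fun x => c + x)) ?dF//.
- by apply: eq_integral => x _ /=; rewrite !fctE mulr1.
- by move=> x y _ _ xy; rewrite ltrD2l.
- by move=> x _; exact: cvg_cst.
- exact: is_cvg_cst.
- exact: is_cvg_cst.
- split=> //; first by apply: cvg_at_right_filter; exact: Fc.
  by apply: cvg_at_left_filter; exact: Fc.
- exact: continuous_subspaceT.
Qed.

Lemma Rintegral_oppr (R : realType) (M : R) (f : R -> R) :
  0 <= M -> continuous f ->
  \int[leb]_(x in `[- M, M]) f x = \int[leb]_(x in `[- M, M]) f (- x).
Proof.
move=> M0 cf; rewrite /Rintegral -[in LHS](opprK M) opprK.
have := @integration_by_substitution_oppr R f (- M) M.
rewrite opprK => -> //; first by lra.
exact: continuous_subspaceT.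
Qed.

(** * The dispersal operator tested on the arch *)

Section kernel.
Variables (R : realType) (J : R -> R).
Hypothesis J_kernel : dispersal_kernel J.
Let J0 := kernel_ge0 J_kernel.

Lemma kernel_continuous : continuous J.
Proof.
have := kernel_lipschitz J_kernel; rewrite /lipschitz_on => -[M [_ HM]] x.
apply/cvgrPdist_le => e e0.
have Jl y z : `|J y - J z| <= (`|M| + 1) * `|y - z|.
  have := HM (`|M| + 1); rewrite (le_lt_trans (ler_norm M)) ?ltrDl// => /(_ isT (y, z)).
  exact.
near=> y; apply: (le_trans (Jl x y)).
have M0 : 0 < `|M| + 1 by rewrite ltr_wpDl.
rewrite -ler_pdivlMl// mulrC; near: y.
by apply: cvgr_dist_le; [exact: cvg_id|rewrite divr_gt0].
Unshelve. all: by end_near. Qed.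

Lemma kernel_integrable : leb.-integrable setT (EFin \o J).
Proof.
have mJ : measurable_fun setT J.
  by apply: continuous_measurable_fun; exact: kernel_continuous.
apply/integrableP; split; first exact/measurable_EFinP.
under eq_integral => x _ do rewrite /= ger0_norm//.
by rewrite (kernel_mass1 J_kernel) ltey.
Qed.

Lemma kernel_sub_continuous x : continuous (fun y => J (x - y)).
Proof.
move=> y; apply: (@continuous_comp _ _ _ (fun y => x - y) J).
  by apply: cvgB; [exact: cvg_cst|exact: cvg_id].
exact: kernel_continuous.
Qed.

Lemma kernel_mass_le1 (x a b : R) : a <= b ->
  \int[leb]_(y in `[a, b]) J (x - y) <= 1.
Proof.
move=> ab.
have E c : x + (c - x) = c by ring.
rewrite -{1}(E a) -{1}(E b).
rewrite Rintegral_translate//; [|lra|exact: kernel_sub_continuous].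
under eq_Rintegral => y _ do rewrite opprD addrA subrr add0r -(kernel_sym J_kernel).
have -> : 1 = \int[leb]_(x in [set: measurableTypeR R]) J x.
  by rewrite /Rintegral (kernel_mass1 J_kernel).
apply: le_Rintegral_patch => //.
- apply/integrable_itv_continuous/continuous_subspaceT; exact: kernel_continuous.
- exact: kernel_integrable.
- by move=> y; rewrite patch_setT patchE; case: ifP => // _; exact: J0.
Qed.

(** Continuity from below of the finite measure with density J. *)
Lemma kernel_mass_near1 (e : R) : 0 < e ->
  exists2 M : R, 0 < M & 1 - e <= \int[leb]_(x in `[- M, M]) J x.
Proof.
move=> e0.
pose F (n : nat) : set (measurableTypeR R) := `[(- n%:R : R), n%:R]%classic.
have FT : \bigcup_n F n = setT.
  apply/seteqP; split => // x _; exists (Num.bound `|x|) => //=.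
  rewrite /F /= in_itv/= -ler_norml ltW//.
  by rewrite (le_lt_trans _ (archi_boundP _)).
have Ji n : leb.-integrable (F n) (EFin \o J).
  apply/integrable_itv_continuous/continuous_subspaceT; exact: kernel_continuous.
have cvF : (\int[leb]_(x in F n) (J x)%:E)%E @[n --> \oo] --> (1 : \bar R)%E.
  rewrite -(kernel_mass1 J_kernel) -FT.
  apply: ge0_nondecreasing_set_cvg_integral.
  - move=> m n mn; rewrite subsetEset => x; rewrite /F /= !in_itv/= -!ler_norml.
    by move=> /le_trans; apply; rewrite ler_nat.
  - by move=> n; exact: measurable_itv.
  - move=> n; have /integrableP[] := Ji n.
    by [].
  - by move=> n x _; rewrite lee_fin.
have /fine_cvgP[_ /cvgrPdist_le /(_ e e0) [N _ HN]] := cvF.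
exists N.+1%:R => //.
have := HN N.+1 (leqnSn N); rewrite /= ler_norml => /andP[_].
by rewrite /Rintegral; lra.
Qed.

(** Choose M such that [-M, M] carries almost all the mass of J.  For L >= M the
window [x - M, x + M] stays within distance 2 L of the origin, so that replacing
[-L, L] by it only adds points where the cosine is nonpositive and removes
points where it is nonnegative.  On that window the symmetry of J turns
phi(x + z) into the average of phi(x + z) and phi(x - z), which is
phi(x) phi(z), and phi(z) is close to 1 for |z| <= M. *)
Lemma kernel_arch (k : R) : 0 < k -> exists2 L0 : R, 0 < L0 &
  forall L x, L0 <= L -> `|x| <= L ->
  (1 - k) * arch L x <= \int[leb]_(y in `[- L, L]) (J (x - y) * arch L y).
Proof.
(* Two losses of a factor 1 - e are incurred, and (1 - e)^2 >= 1 - 2 e >= 1 - k. *)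
move=> k0; pose e := Num.min (k / 2) 1.
have e0 : 0 < e by rewrite lt_min ltr01 andbT divr_gt0.
have e1 : e <= 1 by rewrite ge_min lexx orbT.
have ek : 2 * e <= k by rewrite mulrC -ler_pdivlMr// ge_min lexx.
have [M M0 JM] := kernel_mass_near1 e0.
have [L1 L10 archM] := arch_near1 M e0.
exists (Num.max L1 M); first by rewrite lt_max L10.
move=> L x; rewrite ge_max => /andP[L1L ML] xL.
have L0 : 0 < L by exact: lt_le_trans L1L.
have ac : continuous (arch L) by exact: continuous_arch.
have integ a b (f : R -> R) : continuous f -> leb.-integrable `[a, b] (EFin \o f).
  by move=> cf; apply: integrable_itv_continuous; exact: continuous_subspaceT.
have Fc : continuous (fun y => J (x - y) * arch L y).
  by move=> y; apply: cvgM; [exact: kernel_sub_continuous|exact: ac].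
apply: (@le_trans _ _ (\int[leb]_(y in `[x + - M, x + M]) (J (x - y) * arch L y))).
  have -> : \int[leb]_(y in `[x + - M, x + M]) (J (x - y) * arch L y) =
      \int[leb]_(z in `[- M, M]) (J z * arch L (x + z)).
    rewrite Rintegral_translate//; last by lra.
    apply: eq_Rintegral => z _.
    by rewrite opprD addrA subrr add0r -(kernel_sym J_kernel).
  (* The parameter s = 1 or -1 distinguishes z and its reflection. *)
  have Gc s : continuous (fun z => J z * arch L (x + s * z)).
    move=> z; apply: cvgM; first exact: kernel_continuous.
    apply: (@continuous_comp _ _ _ (fun z => x + s * z) (arch L)); last exact: ac.
    by apply: cvgD; [exact: cvg_cst|apply: cvgM; [exact: cvg_cst|exact: cvg_id]].
  set I := Rintegral _ _ _.
  have I1 : I = \int[leb]_(z in `[- M, M]) (J z * arch L (x + 1 * z)).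
    by apply: eq_Rintegral => z _; rewrite mul1r.
  have I2 : I = \int[leb]_(z in `[- M, M]) (J z * arch L (x + -1 * z)).
    rewrite I1 Rintegral_oppr ?ltW//.
    by apply: eq_Rintegral => z _; rewrite -(kernel_sym J_kernel) mul1r mulN1r.
  have II : 2 * I = \int[leb]_(z in `[- M, M])
      (J z * arch L (x + 1 * z) + J z * arch L (x + -1 * z)).
    by rewrite RintegralD// -?I1 -?I2 ?mulr_natl ?mulr2n//; apply: integ; exact: Gc.
  have lower : (2 * (1 - e) * arch L x) * \int[leb]_(z in `[- M, M]) J z <= 2 * I.
    rewrite II -RintegralZl//; last by apply: integ; exact: kernel_continuous.
    apply: le_Rintegral => //.
    - apply: integ => z; apply: cvgM; [exact: cvg_cst|exact: kernel_continuous].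
    - by apply: integ => z; apply: cvgD; exact: Gc.
    - move=> z; rewrite /= in_itv/= -ler_norml => zM.
      rewrite mul1r mulN1r -mulrDr arch_sym mulrC.
      apply: ler_wpM2l; first exact: J0.
      rewrite -mulrA ler_pM2l// mulrC ler_wpM2l ?arch_ge0//.
      exact: archM.
  have ax : 0 <= arch L x by exact: arch_ge0.
  set m := Rintegral _ _ _ in JM lower.
  have : (1 - k) * arch L x <= ((1 - e) * m) * arch L x.
    apply: ler_wpM2r => //; nra.
  nra.
apply: le_Rintegral_patch => //; [exact: integ|exact: integ|].
move=> y; rewrite !patchE.
have -> : (y \in `[x + - M, x + M]%classic) = (`|y - x| <= M).
  by apply/idP/idP; rewrite inE /= in_itv/= ler_distl.
have -> : (y \in `[- L, L]%classic) = (`|y| <= L).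
  by apply/idP/idP; rewrite inE /= in_itv/= ler_norml.
case: ifP => yx; case: ifP => yL //.
  rewrite mulr_ge0_le0//; apply: arch_le0 => //.
  rewrite ltW ?ltNge ?yL//= -[y](subrK x) (le_trans (ler_normD _ _))// mulr2n lerD//.
  exact: le_trans ML.
by rewrite mulr_ge0// arch_ge0.
Qed.

End kernel.

Section dispersal_comparison.
Variables (R : realType) (J w : R -> R) (a b L x s : R).
Hypothesis J_kernel : dispersal_kernel J.
Hypothesis wc : {within `[a, b], continuous w}.
Hypothesis Lab : a <= - L <= L /\ L <= b.

Let J0 y : 0 <= J (x - y). Proof. exact: kernel_ge0. Qed.

Let aLb : a <= b.
Proof. by case: Lab => /andP[aL LL] Lb; rewrite (le_trans aL)// (le_trans LL). Qed.

Let L_ab y : `|y| <= L -> a <= y <= b.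
Proof.
case: Lab => /andP[aL LL] Lb; rewrite ler_norml => /andP[Ly yL].
by rewrite (le_trans aL)//= (le_trans yL).
Qed.

Let Jw_integrable : leb.-integrable `[a, b] (EFin \o (fun y => J (x - y) * w y)).
Proof.
apply: integrable_itv_continuous => y; apply: continuousM; last exact: wc.
by apply: continuous_subspaceT; exact: kernel_sub_continuous.
Qed.

Let Jarch_integrable k :
  leb.-integrable `[- L, L] (EFin \o (fun y => k * (J (x - y) * arch L y))).
Proof.
apply: integrable_itv_continuous; apply: continuous_subspaceT => y.
apply: cvgM; first exact: cvg_cst.
by apply: cvgM; [exact: kernel_sub_continuous|exact: continuous_arch].
Qed.

Let Jarch_integrable1 :
  leb.-integrable `[- L, L] (EFin \o (fun y => J (x - y) * arch L y)).
Proof.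
apply: integrable_itv_continuous; apply: continuous_subspaceT => y.
by apply: cvgM; [exact: kernel_sub_continuous|exact: continuous_arch].
Qed.

Let in_ab y : (y \in `[a, b]%classic) = (a <= y <= b).
Proof. by apply/idP/idP; rewrite inE /= in_itv/=. Qed.

Let in_LL y : (y \in `[- L, L]%classic) = (`|y| <= L).
Proof. by apply/idP/idP; rewrite inE /= in_itv/= ler_norml. Qed.

Lemma dispersal_below :
  (forall y, a <= y <= b -> 0 <= w y) ->
  (forall y, `|y| <= L -> s * arch L y <= w y) ->
  s * \int[leb]_(y in `[- L, L]) (J (x - y) * arch L y) <=
  \int[leb]_(y in `[a, b]) (J (x - y) * w y).
Proof.
move=> w0 sw; rewrite -RintegralZl//.
apply: le_Rintegral_patch => // y; rewrite !patchE in_ab in_LL.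
case: ifPn => yL; case: ifPn => yab //.
- by rewrite mulrCA ler_wpM2l ?sw.
- by rewrite L_ab in yab.
- by rewrite mulr_ge0 ?w0.
Qed.

(** On the whole of [a, b] one has w <= s - K phi, with phi extended by zero, and
the integral of s against J is at most s. *)
Lemma dispersal_above (K : R) : 0 <= s ->
  (forall y, a <= y <= b -> w y <= s) ->
  (forall y, `|y| <= L -> w y + K * arch L y <= s) ->
  \int[leb]_(y in `[a, b]) (J (x - y) * w y) +
  K * \int[leb]_(y in `[- L, L]) (J (x - y) * arch L y) <= s.
Proof.
move=> s0 ws sw.
have Js : leb.-integrable `[a, b] (EFin \o (fun y => s * J (x - y))).
  apply: integrable_itv_continuous; apply: continuous_subspaceT => y.
  by apply: cvgM; [exact: cvg_cst|exact: kernel_sub_continuous].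
have Ji : leb.-integrable `[a, b] (EFin \o (fun y => J (x - y))).
  apply: integrable_itv_continuous; apply: continuous_subspaceT.
  exact: kernel_sub_continuous.
have KJ : K * \int[leb]_(y in `[- L, L]) (J (x - y) * arch L y) <=
    \int[leb]_(y in `[a, b]) (s * J (x - y) - J (x - y) * w y).
  rewrite -RintegralZl//.
  apply: le_Rintegral_patch => //.
    have sJc : {within `[a, b], continuous (fun y => s * J (x - y))}.
      apply: continuous_subspaceT => y.
      by apply: cvgM; [exact: cvg_cst|exact: kernel_sub_continuous].
    have Jwc : {within `[a, b], continuous (fun y => J (x - y) * w y)}.
      move=> y; apply: continuousM; last exact: wc.
      by apply: continuous_subspaceT; exact: kernel_sub_continuous.
    by apply: integrable_itv_continuous => y; apply: cvgB; [exact: sJc|exact: Jwc].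
  move=> y; rewrite !patchE in_ab in_LL.
  case: ifPn => yL; case: ifPn => yab //.
  - by rewrite mulrCA [s * _]mulrC -mulrBr ler_wpM2l// lerBrDl sw.
  - by rewrite L_ab in yab.
  - by rewrite [s * _]mulrC -mulrBr mulr_ge0// subr_ge0 ws.
move: KJ; rewrite RintegralB// RintegralZl// => KJ.
have : s * \int[leb]_(y in `[a, b]) J (x - y) <= s.
  by rewrite ler_piMr// (kernel_mass_le1 J_kernel).
lra.
Qed.

End dispersal_comparison.

(** * Comparison for logistic growth with diffusion *)

Lemma ex_gt3 (R : realType) (a b c : R) : exists x, [/\ a < x, b < x & c < x].
Proof.
pose m := Num.max a (Num.max b c).
have m1 : m < m + 1 by rewrite ltrDl.
by exists (m + 1); split; apply: le_lt_trans m1; rewrite !le_max lexx ?orbT.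
Qed.

Definition liminf_ge (R : realType) (w : R -> R -> R) (A : R) : Prop :=
  forall L e : R, 0 < e ->
  exists T : R, forall t x, T < t -> `|x| <= L -> A - e <= w t x.

Definition limsup_le (R : realType) (w : R -> R -> R) (A : R) : Prop :=
  forall L e : R, 0 < e ->
  exists T : R, forall t x, T < t -> `|x| <= L -> w t x <= A + e.

(** What the comparison arguments need to know about a bounded positive solution
of w_t = D w + w (r - w), uniformly for the diffusion operators D at hand: [k]
bounds the loss due to D, relative to [w], where the graph of [w] touches an arch
from above, and the gain due to D where it touches the graph of [s - K phi] from
below. *)
Record logistic_comparison (R : realType) (K : R) (r w : R -> R -> R) : Prop := {
  lc_regular : forall L : R, exists T : R, forall t x, T < t -> `|x| <= L ->
    0 < w t x <= K /\ {for (t, x), continuous (fun z => w z.1 z.2)};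
  lc_below : forall k : R, 0 < k -> exists2 L0 : R, 0 < L0 &
    forall L : R, L0 <= L -> exists T : R, forall t x s, T < t -> `|x| < L ->
    0 <= s -> (forall y, `|y| <= L -> s * arch L y <= w t y) ->
    w t x = s * arch L x ->
    exists2 l, is_derive t 1 (w ^~ x) l & (r t x - w t x - k) * w t x <= l;
  lc_above : forall k : R, 0 < k -> exists2 L0 : R, 0 < L0 &
    forall L : R, L0 <= L -> exists T : R, forall t x s, T < t -> `|x| < L ->
    K <= s -> (forall y, `|y| <= L -> w t y + K * arch L y <= s) ->
    w t x + K * arch L x = s ->
    exists2 l, is_derive t 1 (w ^~ x) l & l <= w t x * (r t x - w t x) + k
}.

Lemma continuous_barrier (R : realType) (s : R -> R) (L t x : R) :
  continuous s -> {for (t, x), continuous (fun z : R * R => s z.1 * arch L z.2)}.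
Proof.
move=> cs; apply: cvgM.
  apply: (@continuous_comp _ _ _ fst s); [exact: cvg_fst|exact: cs].
apply: (@continuous_comp _ _ _ snd (arch L)); [exact: cvg_snd|exact: continuous_arch].
Qed.

Section logistic.
Variables (R : realType) (K : R) (r w : R -> R -> R).
Hypothesis lc : logistic_comparison K r w.

(** The barrier is s(t) phi(x) with s(t) = min (B, s0 + c (t - T)).  Here
B = A - d / 2 leaves room below A, s0 lies below the minimum of w at time T, and
the slope c = s0 d / 8 is so small that, at a contact, the growth rate d / 4 of
w exceeds the relative growth c / s <= d / 8 of the barrier. *)
Lemma liminf_ge_logistic (A : R) : 0 < A -> liminf_ge r A -> liminf_ge w A.
Proof.
move=> A0 rA L e e_gt0; pose d := Num.min e A.
have d0 : 0 < d by rewrite lt_min e_gt0.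
have de : d <= e by rewrite ge_min lexx.
have dA : d <= A by rewrite ge_min lexx orbT.
have [|L1 L10 H1] := lc_below lc (k := d / 8); first by rewrite divr_gt0.
have [|L2 L20 H2] := @arch_near1 R L (d / (2 * A)).
  by rewrite divr_gt0// mulr_gt0.
pose l := Num.max L1 (Num.max L2 `|L|).
have L1l : L1 <= l by rewrite le_max lexx.
have L2l : L2 <= l by rewrite !le_max lexx orbT.
have Ll : `|L| <= l by rewrite !le_max lexx !orbT.
have l0 : 0 < l by exact: lt_le_trans L1l.
have [T1 HT1] := H1 l L1l.
have [T2 HT2] := lc_regular lc l.
have [|T3 HT3] := rA l (d / 8); first by rewrite divr_gt0.
have [T [T1T T2T T3T]] := ex_gt3 T1 T2 T3.
have wcont t y : T <= t -> `|y| <= l -> {for (t, y), continuous (fun z => w z.1 z.2)}.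
  by move=> Tt yl; have [] := HT2 t y (lt_le_trans T2T Tt) yl.
have wpos t y : T <= t -> `|y| <= l -> 0 < w t y.
  by move=> Tt yl; have [/andP[]] := HT2 t y (lt_le_trans T2T Tt) yl.
have [m m0 wm] : exists2 m, 0 < m & forall y, `|y| <= l -> m <= w T y.
  have : {within `[- l, l], continuous (w T)}.
    apply: continuous_in_subspaceT => y; rewrite inE /= in_itv/= -ler_norml => yl.
    apply: (@continuous_comp _ _ _ (fun y : R => (T, y)) (fun z => w z.1 z.2)).
      by apply: (@cvg_pair _ _ _ (nbhs y) (nbhs T) (nbhs y));
        [exact: cvg_cst|exact: cvg_id].
    exact: wcont.
  move=> /EVT_min[|c cl cmin]; first by lra.
  exists (w T c); first by apply: wpos => //; rewrite ler_norml.
  by move=> y yl; apply: cmin; rewrite in_itv/= -ler_norml.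
pose B := A - d / 2.
have B0 : 0 < B by rewrite /B; lra.
pose s0 := Num.min (m / 2) B.
have s00 : 0 < s0 by rewrite lt_min B0 andbT divr_gt0.
have s0m : s0 < m by rewrite gt_min; apply/orP; left; lra.
pose c := s0 * (d / 8).
have c0 : 0 < c by rewrite mulr_gt0// divr_gt0.
pose s t := Num.min B (s0 + c * (t - T)).
have sc : continuous s.
  move=> t; apply: (@continuous_min _ _ (fun=> B) (fun t => s0 + c * (t - T))).
    exact: cvg_cst.
  apply: cvgD; first exact: cvg_cst.
  by apply: cvgM; [exact: cvg_cst|apply: cvgB; [exact: cvg_id|exact: cvg_cst]].
have sB t : s t <= B by rewrite ge_min lexx.
have ss0 t : T <= t -> s0 <= s t.
  by move=> Tt; rewrite le_min ge_min lexx orbT/= lerDl mulr_ge0 ?(ltW c0)// subr_ge0.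
have sl t t' : t' <= t -> s t - s t' <= c * (t - t').
  move=> tt'; have ctt : 0 <= c * (t - t') by rewrite mulr_ge0 ?(ltW c0)// subr_ge0.
  have sBt := sB t.
  have st : s t <= s0 + c * (t' - T) + c * (t - t').
    by rewrite (_ : _ + c * (t - t') = s0 + c * (t - T)) ?ge_min ?lexx ?orbT//; ring.
  by rewrite [s t']/s minEle; case: ifP => _; lra.
have main : forall t x, T <= t -> `|x| <= l -> 0 < w t x - s t * arch l x.
  apply: first_touching.
  - move=> t x Tt xl; apply: cvgB; first exact: wcont.
    exact: continuous_barrier.
  - move=> x xl; rewrite subr_gt0 (lt_le_trans _ (wm x xl))// (le_lt_trans _ s0m)//.
    rewrite /s subrr mulr0 addr0.
    have -> : Num.min B s0 = s0 by apply/min_idPr; rewrite ge_min lexx orbT.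
    by rewrite ler_piMr ?arch_le1// ltW.
  - move=> t x Tt xl /eqP; rewrite subr_eq0 => /eqP wE wmin wbefore.
    (* At the ends of the window the barrier vanishes, while w is positive. *)
    have xl' : `|x| < l.
      rewrite lt_neqAle xl andbT; apply/eqP => /(arch_end l0) ax.
      by have := wpos t x (ltW Tt) xl; rewrite wE ax mulr0 ltxx.
    have a0 : 0 < arch l x by exact: arch_gt0.
    have st0 : 0 < s t by exact: lt_le_trans (ss0 t (ltW Tt)).
    have [|y yl|//|D Dd wD] := HT1 t x (s t) (lt_trans T1T Tt) xl'.
    + exact: ltW.
    + by rewrite -subr_ge0; exact: wmin.
    have Dc : D <= c * arch l x.
      apply: (derive1_le_left Tt Dd) => t' Tt' t't.
      have := wbefore t' Tt' t't; have := sl t t' (ltW t't); rewrite wE.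
      nra.
    have rt := HT3 t x (lt_trans T3T Tt) xl.
    have ax1 : arch l x <= 1 by exact: arch_le1.
    have w0 : 0 < w t x by rewrite wE mulr_gt0.
    have wB : w t x <= B by rewrite wE (le_trans _ (sB t))// ler_piMr// ltW.
    have : d / 4 * w t x <= D.
      by apply: le_trans wD; apply: ler_wpM2r; [exact: ltW|rewrite /B in wB; lra].
    have : c * arch l x < d / 4 * w t x.
      rewrite wE mulrA ltr_pM2r// /c.
      have : s0 * (d / 4) <= s t * (d / 4).
        by apply: ler_wpM2r; [rewrite divr_ge0// ltW|exact: ss0 (ltW Tt)].
      have : 0 < s0 * d by rewrite mulr_gt0.
      lra.
    lra.
exists (T + B / c) => t x Tt xL.
have TT : T <= t.
  by apply: (le_trans _ (ltW Tt)); rewrite lerDl; apply: divr_ge0; exact: ltW.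
have xL' : `|x| <= L by [].
have xl : `|x| <= l by rewrite (le_trans xL)// (le_trans (ler_norm L)).
have sE : s t = B.
  apply/min_idPl; rewrite ltW// ltr_wpDl ?(ltW s00)// mulrC -ltr_pdivrMr//.
  by rewrite ltrBrDl.
have := main t x TT xl; rewrite sE subr_gt0 => /ltW; apply: le_trans.
have aq := H2 l x L2l xL.
have dAE : d / (2 * A) * A = d / 2 by field; rewrite gt_eqF.
have q0 : 0 <= d / (2 * A) by rewrite divr_ge0// ?mulr_ge0// ltW.
have : B * (1 - d / (2 * A)) <= B * arch l x.
  by apply: ler_wpM2l aq; exact: ltW.
rewrite {1}/B; nra.
Qed.

(** The barrier is s(t) - K phi(x) with s(t) = max (K + B, S - c (t - T)) and
B = A + e / 2.  As phi <= 1, at a contact w >= s - K >= B, so that w decreases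
at least at the rate B e / 4 - c / 2 = 3 c / 2, faster than the barrier. *)
Lemma limsup_le_logistic (A : R) : 0 < K -> 0 <= A -> limsup_le r A -> limsup_le w A.
Proof.
move=> K0 A0 rA L e e0.
pose B := A + e / 2.
have B0 : 0 < B by rewrite /B; lra.
pose c := B * (e / 8).
have c0 : 0 < c by rewrite mulr_gt0// divr_gt0.
have [|L1 L10 H1] := lc_above lc (k := c / 2); first by rewrite divr_gt0.
have [|L2 L20 H2] := @arch_near1 R L (e / (2 * K)).
  by rewrite divr_gt0// mulr_gt0.
pose l := Num.max L1 (Num.max L2 `|L|).
have L1l : L1 <= l by rewrite le_max lexx.
have L2l : L2 <= l by rewrite !le_max lexx orbT.
have Ll : `|L| <= l by rewrite !le_max lexx !orbT.
have l0 : 0 < l by exact: lt_le_trans L1l.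
have [T1 HT1] := H1 l L1l.
have [T2 HT2] := lc_regular lc l.
have [|T3 HT3] := rA l (e / 4); first by rewrite divr_gt0.
have [T [T1T T2T T3T]] := ex_gt3 T1 T2 T3.
have wcont t y : T <= t -> `|y| <= l -> {for (t, y), continuous (fun z => w z.1 z.2)}.
  by move=> Tt yl; have [] := HT2 t y (lt_le_trans T2T Tt) yl.
have wK t y : T <= t -> `|y| <= l -> w t y <= K.
  by move=> Tt yl; have [/andP[]] := HT2 t y (lt_le_trans T2T Tt) yl.
pose S := K + B + K + 1.
pose s t := Num.max (K + B) (S - c * (t - T)).
have sc : continuous s.
  move=> t; apply: (@continuous_max _ _ (fun=> K + B) (fun t => S - c * (t - T))).
    exact: cvg_cst.
  apply: cvgB; first exact: cvg_cst.
  by apply: cvgM; [exact: cvg_cst|apply: cvgB; [exact: cvg_id|exact: cvg_cst]].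
have sB t : K + B <= s t by rewrite le_max lexx.
have sl t t' : t' <= t -> - c * (t - t') <= s t - s t'.
  move=> tt'; have ctt : 0 <= c * (t - t') by rewrite mulr_ge0 ?(ltW c0)// subr_ge0.
  have sBt := sB t.
  have st : S - c * (t' - T) - c * (t - t') <= s t.
    by rewrite (_ : _ - c * (t - t') = S - c * (t - T)) ?le_max ?lexx ?orbT//; ring.
  by rewrite [s t']/s maxEle; case: ifP => _; lra.
have main : forall t x, T <= t -> `|x| <= l -> 0 < s t - (w t x + K * arch l x).
  apply: first_touching.
  - move=> t x Tt xl; apply: cvgB.
      by apply: (@continuous_comp _ _ _ fst s); [exact: cvg_fst|exact: sc].
    apply: cvgD; first exact: wcont.
    by apply: (@continuous_barrier R (fun=> K)) => ?; exact: cvg_cst.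
  - move=> x xl; rewrite subr_gt0 /s subrr mulr0 subr0 lt_max; apply/orP; right.
    have : K * arch l x <= K by rewrite ler_piMr ?arch_le1// ltW.
    have := wK T x (lexx T) xl; rewrite /S; lra.
  - move=> t x Tt xl /eqP; rewrite subr_eq0 => /eqP wE wmin wbefore.
    have := sB t => sBt.
    (* At the ends of the window the barrier is s >= K + B > K >= w. *)
    have xl' : `|x| < l.
      rewrite lt_neqAle xl andbT; apply/eqP => /(arch_end l0) ax.
      have := wK t x (ltW Tt) xl; rewrite ax mulr0 addr0 in wE; lra.
    have [|y yl|//|D Dd wD] := HT1 t x (s t) (lt_trans T1T Tt) xl'.
    + lra.
    + by rewrite -subr_ge0; exact: wmin.
    have Dc : - c <= D.
      apply: (derive1_ge_left Tt Dd) => t' Tt' t't.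
      have := wbefore t' Tt' t't; have := sl t t' (ltW t't); rewrite wE.
      lra.
    have rt := HT3 t x (lt_trans T3T Tt) xl.
    have : K * arch l x <= K by rewrite ler_piMr ?arch_le1// ltW.
    move=> Ka; have wB : B <= w t x by lra.
    have : w t x * (r t x - w t x) <= B * (- (e / 4)).
      have rw : e / 4 <= w t x - r t x by rewrite /B in wB; lra.
      have : B * (e / 4) <= w t x * (w t x - r t x).
        by apply: ler_pM => //; [exact: ltW|rewrite divr_ge0// ltW].
      lra.
    rewrite /c in Dc wD *; have : 0 < B * e by rewrite mulr_gt0.
    lra.
exists (T + (S - (K + B)) / c) => t x Tt xL.
have TT : T <= t.
  apply: (le_trans _ (ltW Tt)); rewrite lerDl; apply: divr_ge0; last exact: ltW.
  by rewrite /S; lra.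
have xl : `|x| <= l by rewrite (le_trans xL)// (le_trans (ler_norm L)).
have sE : s t = K + B.
  apply/max_idPl; rewrite lerBlDr -lerBlDl ltW// mulrC -ltr_pdivrMr//.
  by rewrite ltrBrDl.
have := main t x TT xl; rewrite sE subr_gt0.
have aq := H2 l x L2l xL.
have dAE : K * (e / (2 * K)) = e / 2 by field; rewrite gt_eqF.
have : K * (1 - e / (2 * K)) <= K * arch l x.
  by apply: ler_wpM2l aq; exact: ltW.
rewrite /B mulrBr dAE; lra.
Qed.

End logistic.

(** * The components of the free boundary problem *)

Section free_boundary.
Variables (R : realType) (u v : R -> R -> R) (g h : R -> R).
Hypothesis reg : FBP_regularity u v g h.
Hypotheses (gNy : g t @[t --> +oo] --> -oo) (hy : h t @[t --> +oo] --> +oo).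

Lemma eventually_inside (L : R) :
  exists2 T : R, 0 < T & forall t, T < t -> g t < - L /\ L < h t.
Proof.
have /cvgrNyPlt/(_ (- L)) [T1 [_ HT1]] := gNy.
have /cvgryPgt/(_ L) [T2 [_ HT2]] := hy.
exists (Num.max 1 (Num.max T1 T2)); first by rewrite lt_max ltr01.
move=> t; rewrite !gt_max => /and3P[_ T1t T2t].
by split; [exact: HT1|exact: HT2].
Qed.

Lemma u_lipschitz (S : R) : 0 < S ->
  exists2 M : R, 0 < M & forall s y z, 0 <= s <= S -> g s <= y <= h s ->
    g s <= z <= h s -> `|u s y - u s z| <= M * `|y - z|.
Proof.
move=> S0; have [M HM] := reg_u_lipschitz reg S0.
exists (`|M| + 1); first by rewrite ltr_wpDl.
move=> s y z sS ys zs.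
have := HM s sS (y, z) _; rewrite /= !in_itv/= => /(_ (conj ys zs)) /le_trans; apply.
by rewrite ler_wpM2r// (le_trans (ler_norm M))// lerDl.
Qed.

(** From time [T] on, the window [-L, L] lies in the interior of the habitat, so
the one-sided notions relative to the moving domain become the usual ones
there. *)
Section inside.
Variables (L T : R).
Hypothesis T_gt0 : 0 < T.
Hypothesis insideT : forall t, T < t -> g t < - (L + 1) /\ L + 1 < h t.
Variables (t x : R).
Hypotheses (Tt : T < t) (xL : `|x| <= L).

Let inside s y : T < s -> `|y| <= L + 1 -> g s < y < h s.
Proof.
move=> /insideT[gs hs]; rewrite ler_norml => /andP[Ly yL].
by rewrite (lt_le_trans gs)//= (le_lt_trans yL).
Qed.

Let xL1 : `|x| <= L + 1.
Proof. by rewrite (le_trans xL)// lerDl. Qed.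

Lemma inside_domain : nbhs (t, x) (moving_domain g h).
Proof.
have nt : nbhs t [set s | T < s] by apply: open_nbhs_nbhs; split; [exact: open_gt|].
have nx : nbhs x [set y | `|y| < L + 1].
  apply: open_nbhs_nbhs; split; last by rewrite /= (le_lt_trans xL)// ltrDl.
  by apply: (open_comp _ (@open_lt R (L + 1))) => y _; exact: norm_continuous.
exists ([set s | T < s], [set y | `|y| < L + 1]) => //= -[s y] [/= Ts yL].
rewrite /moving_domain /= (le_trans (ltW T_gt0) (ltW Ts)); split => //.
by have /andP[] := inside Ts (ltW yL) => /ltW -> /ltW ->.
Qed.

Lemma inside_time : nbhs t (time_section g h x).
Proof.
apply: (@filterS _ _ _ [set s | T < s]); last first.
  by apply: open_nbhs_nbhs; split; [exact: open_gt|].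
move=> s /= Ts; split; first exact: (le_trans (ltW T_gt0) (ltW Ts)).
have /andP[] := inside Ts xL1.
by move=> /ltW /= -> /ltW ->.
Qed.

Lemma inside_space (y : R) : `|y| < L + 1 -> nbhs y (space_section g h t).
Proof.
move=> /ltW/(inside Tt) yin; rewrite /space_section.
apply: (@filterS _ _ _ `]g t, h t[%classic); first exact: subset_itv_oo_cc.
by apply: open_nbhs_nbhs; split; [exact: itv_open|rewrite /= in_itv].
Qed.

Lemma inside_derive_t (w : R -> R -> R) :
  derivable_in (time_section g h x) (w ^~ x) t ->
  is_derive t 1 (w ^~ x) (pdt g h w t x).
Proof. exact: derive_in_interior inside_time. Qed.

Lemma inside_derive_x (w : R -> R -> R) (y : R) : `|y| < L + 1 ->
  derivable_in (space_section g h t) (w t) y ->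
  is_derive y 1 (w t) (pdx g h w t y).
Proof. by move=> /inside_space yS; exact: derive_in_interior. Qed.

Lemma inside_dom (y : R) : `|y| <= L + 1 -> moving_domain g h (t, y).
Proof.
move=> /(inside Tt) /andP[gy yh]; split; first exact: (le_trans (ltW T_gt0) (ltW Tt)).
by rewrite /= !ltW.
Qed.

Lemma inside_derive_u : is_derive t 1 (u ^~ x) (pdt g h u t x).
Proof.
apply: inside_derive_t; apply: (reg_u_dt reg); exact: inside_dom.
Qed.

Lemma inside_v_slab (y : R) : `|y| <= L + 1 ->
  moving_domain_slab g h (t / 2) (t + 1) (t, y).
Proof.
have t0 := lt_trans T_gt0 Tt.
move=> /(inside Tt) /andP[gy yh]; split => /=; last by rewrite !ltW.
by rewrite lerDl ler01 andbT ler_pdivrMr// ler_pMr// ler1n.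
Qed.

Lemma inside_v_parabolic : exists alpha, C_parabolic g h alpha (t / 2) (t + 1) v.
Proof.
have t0 := lt_trans T_gt0 Tt.
have [alpha _ /(_ (t / 2) (t + 1)) H] := reg_holder reg; exists alpha.
have [] // := H _.
rewrite divr_gt0//= (@lt_trans _ _ t) ?ltrDl//.
by rewrite ltr_pdivrMr// ltr_pMr// ltr1n.
Qed.

Lemma inside_derive_v : is_derive t 1 (v ^~ x) (pdt g h v t x).
Proof.
have [alpha vC] := inside_v_parabolic.
apply: inside_derive_t; apply: (Cpar_dt vC); exact: inside_v_slab.
Qed.

Lemma inside_derive_vx (y : R) : `|y| < L + 1 -> is_derive y 1 (v t) (pdx g h v t y).
Proof.
by move=> yL; apply: inside_derive_x => //; apply: (reg_v_dx reg); apply/inside_dom/ltW.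
Qed.

Lemma inside_derive_vxx : is_derive x 1 (pdx g h v t) (pdxx g h v t x).
Proof.
have xL2 : `|x| < L + 1 by rewrite (le_lt_trans xL)// ltrDl.
have [alpha vC] := inside_v_parabolic.
by apply: inside_derive_x => //; apply: (Cpar_dxx vC); exact: inside_v_slab.
Qed.

Lemma inside_continuous_v : {for (t, x), continuous (fun z => v z.1 z.2)}.
Proof.
have /subspace_continuousP/(_ (t, x)) := reg_v_continuous reg.
rewrite (within_filterE inside_domain); apply.
exact: inside_dom.
Qed.

(** Lipschitz continuity in x, uniform for bounded times, together with
continuity in t at fixed x gives joint continuity. *)
Lemma inside_continuous_u : {for (t, x), continuous (fun z => u z.1 z.2)}.
Proof.
have t0 := lt_trans T_gt0 Tt.
have [|M M0 uM] := @u_lipschitz (t + 1); first by rewrite addr_gt0.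
have [du _] := inside_derive_u.
have ct : {for t, continuous (u ^~ x)}.
  by apply: differentiable_continuous; exact/derivable1_diffP.
have c1 : {for (t, x), continuous (fun z : R * R => u z.1 x)}.
  by apply: (@continuous_comp _ _ _ fst (u ^~ x)); [exact: cvg_fst|exact: ct].
apply/cvgrPdist_lt => e e0.
have e20 : 0 < e / 2 by rewrite divr_gt0.
have nT : \forall z \near (t, x), T < z.1 /\ z.1 <= t + 1.
  exists (`]T, t + 1[%classic, setT); last first.
    by move=> [s y] [/=]; rewrite in_itv/= => /andP[-> /ltW].
  split; last exact: filterT.
  apply: open_nbhs_nbhs; split; first exact: itv_open.
  by rewrite /= in_itv/= Tt ltrDl ltr01.
near=> z.
have zD : moving_domain g h z by near: z; exact: inside_domain.
case: (zD) => z10 z1z2.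
have [z1T z1t] : T < z.1 /\ z.1 <= t + 1 by near: z; exact: nT.
rewrite -(subrKA (u z.1 x)) (le_lt_trans (ler_normD _ _))// (splitr e) ltrD//.
  by near: z; apply: cvgr_dist_lt c1 _ e20.
have xz : g z.1 <= x <= h z.1.
  have /andP[] := inside z1T xL1.
  by move=> /ltW -> /ltW ->.
rewrite (le_lt_trans (uM _ _ _ _ xz z1z2)) ?z10//.
rewrite -ltr_pdivlMl// mulrC; near: z.
by apply: cvgr_dist_lt; [exact: cvg_snd|rewrite divr_gt0].
Unshelve. all: by end_near. Qed.

End inside.
End free_boundary.

Section solution_comparison.
Variables (R : realType) (d1 d2 mu rho h0 : R) (J u0 v0 : R -> R).
Variables (r1 r2 : R -> R) (u v : R -> R -> R) (g h : R -> R).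
Hypotheses (d1_gt0 : 0 < d1) (d2_gt0 : 0 < d2).
Hypothesis J_kernel : dispersal_kernel J.
Variables (f1 f2 : R -> R -> R).
Hypothesis f1E : forall u v, f1 u v = u * (r1 v - u).
Hypothesis f2E : forall u v, f2 u v = v * (r2 u - v).
Hypothesis eqs : FBP_equations d1 d2 mu rho h0 J u0 v0 f1 f2 u v g h.
Hypothesis reg : FBP_regularity u v g h.
Variable K : R.
Hypothesis K_gt0 : 0 < K.
Hypothesis bounds : forall t x, 0 < t -> g t < x < h t ->
  0 < u t x <= K /\ 0 < v t x <= K.
Hypotheses (gNy : g t @[t --> +oo] --> -oo) (hy : h t @[t --> +oo] --> +oo).

Lemma u_between t y : 0 < t -> g t <= y <= h t -> 0 <= u t y <= K.
Proof.
move=> t0 /andP[]; have [ug uh _ _] := FBP_bnd eqs (ltW t0).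
rewrite le_eqVlt => /orP[/eqP <- _|gy]; first by rewrite ug lexx ltW.
rewrite le_eqVlt => /orP[/eqP ->|yh]; first by rewrite uh lexx ltW.
have [|/andP[/ltW -> ->] _ //] := @bounds t y t0.
by rewrite gy.
Qed.

Lemma u_continuous t : 0 < t -> {within `[g t, h t], continuous (u t)}.
Proof.
move=> t0; have [|M M0 uM] := u_lipschitz reg (S := t + 1); first by rewrite addr_gt0.
apply/subspace_continuousP => x /= xgh; apply/cvgrPdist_lt => e e0.
rewrite near_withinE; near=> y => ygh.
have t01 : 0 <= t <= t + 1 by rewrite ltW//= lerDl.
rewrite (le_lt_trans (uM t x y t01 _ _)) -?in_itv//.
rewrite -ltr_pdivlMl// mulrC; near: y.
by apply: cvgr_dist_lt; [exact: cvg_id|rewrite divr_gt0].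
Unshelve. all: by end_near. Qed.

Lemma inside_interior T L t x : 0 < T ->
  (forall t, T < t -> g t < - (L + 1) /\ L + 1 < h t) ->
  T < t -> `|x| <= L -> 0 < t /\ g t < x < h t.
Proof.
move=> T0 insideT Tt; rewrite ler_norml => /andP[Lx xL].
have [gt ht] := insideT t Tt; split; first exact: lt_trans Tt.
apply/andP; split; lra.
Qed.

Lemma inside_window T L t : (forall t, T < t -> g t < - (L + 1) /\ L + 1 < h t) ->
  T < t -> 0 < L -> g t <= - L <= L /\ L <= h t.
Proof.
move=> insideT /insideT[gt ht] L0.
by split; [apply/andP; split|]; lra.
Qed.

(** The error comes from [kernel_arch], used with k / d1 below and k / (d1 K)
above. *)
Lemma u_logistic_comparison :
  logistic_comparison K (fun t x => r1 (v t x)) u.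
Proof.
split.
- move=> L; have [T T0 insideT] := eventually_inside gNy hy (L + 1).
  exists T => t x Tt xL; split; last exact: (inside_continuous_u reg T0 insideT).
  have [t0 tx] := inside_interior T0 insideT Tt xL.
  by have [] := bounds t0 tx.
- move=> k k0; have kd0 : 0 < k / d1 by rewrite divr_gt0.
  have [L0 L00 HL] := kernel_arch J_kernel kd0.
  exists L0 => // L LL; have [T T0 insideT] := eventually_inside gNy hy (L + 1).
  exists T => t x s Tt /ltW xL s0 su ux.
  have [t0 tx] := inside_interior T0 insideT Tt xL.
  exists (pdt g h u t x); first exact: (inside_derive_u reg T0 insideT).
  rewrite (FBP_u eqs t0 tx) f1E.
  have gLh := inside_window insideT Tt (lt_le_trans L00 LL).
  have I1 := dispersal_below x J_kernel (u_continuous t0) gLh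
    (fun y yin => proj1 (andP (u_between t0 yin))) su.
  have I2 := HL L x LL xL.
  have I3 := ler_wpM2l s0 I2.
  set I := \int[leb]_(y in `[g t, h t]) (J (x - y) * u t y) in I1 *.
  have d1I : d1 * ((1 - k / d1) * u t x) <= d1 * I.
    rewrite ler_pM2l//; apply: le_trans I1; apply: le_trans I3.
    by rewrite mulrCA -ux.
  have kE : d1 * ((1 - k / d1) * u t x) = d1 * u t x - k * u t x.
    by field; rewrite gt_eqF.
  rewrite kE in d1I; lra.
- move=> k k0; have kd0 : 0 < k / (d1 * K) by rewrite divr_gt0// mulr_gt0.
  have [L0 L00 HL] := kernel_arch J_kernel kd0.
  exists L0 => // L LL; have [T T0 insideT] := eventually_inside gNy hy (L + 1).
  exists T => t x s Tt /ltW xL Ks su ux.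
  have [t0 tx] := inside_interior T0 insideT Tt xL.
  exists (pdt g h u t x); first exact: (inside_derive_u reg T0 insideT).
  rewrite (FBP_u eqs t0 tx) f1E.
  have gLh := inside_window insideT Tt (lt_le_trans L00 LL).
  have s0 : 0 <= s by rewrite (le_trans (ltW K_gt0)).
  have us y : g t <= y <= h t -> u t y <= s.
    by move=> /(u_between t0) /andP[_ /le_trans]; apply.
  have I1 := dispersal_above x J_kernel (u_continuous t0) gLh s0 us su.
  have I2 := ler_wpM2l (ltW K_gt0) (HL L x LL xL).
  set I := \int[leb]_(y in `[g t, h t]) (J (x - y) * u t y) in I1 *.
  have a1 : arch L x <= 1 by exact: arch_le1.
  have d1I : d1 * I <= d1 * (u t x + k / d1 * arch L x).
    rewrite ler_pM2l//.
    have -> : k / d1 * arch L x = K * (k / (d1 * K) * arch L x).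
      by field; rewrite !gt_eqF.
    lra.
  have kE : d1 * (u t x + k / d1 * arch L x) = d1 * u t x + k * arch L x.
    by field; rewrite gt_eqF.
  have : k * arch L x <= k by rewrite ler_piMr// ltW.
  rewrite kE in d1I; lra.
Qed.

(** At a contact point v and the barrier are tangent, so their second derivatives
are ordered; the one of an arch is - omega^2 times the arch. *)
Lemma v_logistic_comparison :
  logistic_comparison K (fun t x => r2 (u t x)) v.
Proof.
split.
- move=> L; have [T T0 insideT] := eventually_inside gNy hy (L + 1).
  exists T => t x Tt xL; split; last exact: (inside_continuous_v reg T0 insideT).
  have [t0 tx] := inside_interior T0 insideT Tt xL.
  by have [] := bounds t0 tx.
- move=> k k0; have kd0 : 0 < k / d2 by rewrite divr_gt0.
  have [L0 L00 HL] := arch_frequency_small kd0.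
  exists L0 => // L LL; have [T T0 insideT] := eventually_inside gNy hy (L + 1).
  exists T => t x s Tt xL' s0 sv vx.
  have xL := ltW xL'.
  have [t0 tx] := inside_interior T0 insideT Tt xL.
  exists (pdt g h v t x); first exact: (inside_derive_v reg T0 insideT).
  rewrite (FBP_v eqs t0 tx) f2E.
  have Lin y : y \in `]- L, L[ -> `|y| < L by rewrite in_itv/= ltr_norml.
  have xin : x \in `]- L, L[ by rewrite in_itv/= -ltr_norml.
  have vxx : 0 <= pdxx g h v t x - s * (- (pi / 2 / L) ^+ 2 * arch L x).
    apply: (@second_derivative_test _ (v t - s \*: arch L)
      (pdx g h v t - s \*: arch_slope L) (- L) L x _ xin).
    + move=> y /Lin yL; apply: is_deriveB; last first.
        by apply: is_deriveZ; exact: is_derive_arch.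
      apply: (inside_derive_vx reg T0 insideT Tt).
      by rewrite (lt_trans yL)// ltrDl.
    + apply: is_deriveB; first exact: (inside_derive_vxx reg T0 insideT).
      by apply: is_deriveZ; exact: is_derive_arch_slope.
    + move=> y /Lin yL; rewrite !fctE /GRing.scale /= vx subrr subr_ge0.
      exact/sv/ltW.
  have w0 : 0 <= v t x by have [_ /andP[/ltW]] := bounds t0 tx.
  have := ler_wpM2r w0 (HL L LL).
  have -> : k / d2 * v t x = k * v t x / d2 by rewrite mulrAC.
  rewrite ler_pdivlMr// => kv.
  have := ler_wpM2l (ltW d2_gt0) vxx.
  have -> : s * (- (pi / 2 / L) ^+ 2 * arch L x) = - ((pi / 2 / L) ^+ 2 * v t x).
    by rewrite vx; ring.
  rewrite mulr0; lra.
- move=> k k0; have kd0 : 0 < k / (d2 * K) by rewrite divr_gt0// mulr_gt0.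
  have [L0 L00 HL] := arch_frequency_small kd0.
  exists L0 => // L LL; have [T T0 insideT] := eventually_inside gNy hy (L + 1).
  exists T => t x s Tt xL' Ks sv vx.
  have xL := ltW xL'.
  have [t0 tx] := inside_interior T0 insideT Tt xL.
  exists (pdt g h v t x); first exact: (inside_derive_v reg T0 insideT).
  rewrite (FBP_v eqs t0 tx) f2E.
  have Lin y : y \in `]- L, L[ -> `|y| < L by rewrite in_itv/= ltr_norml.
  have xin : x \in `]- L, L[ by rewrite in_itv/= -ltr_norml.
  have vxx : 0 <= - pdxx g h v t x - K * (- (pi / 2 / L) ^+ 2 * arch L x).
    apply: (@second_derivative_test _ (- v t - K \*: arch L)
      (- pdx g h v t - K \*: arch_slope L) (- L) L x _ xin).
    + move=> y /Lin yL; apply: is_deriveB; last first.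
        by apply: is_deriveZ; exact: is_derive_arch.
      apply: is_deriveN; apply: (inside_derive_vx reg T0 insideT Tt).
      by rewrite (lt_trans yL)// ltrDl.
    + apply: is_deriveB.
        by apply: is_deriveN; exact: (inside_derive_vxx reg T0 insideT).
      by apply: is_deriveZ; exact: is_derive_arch_slope.
    + move=> y /Lin yL; rewrite !fctE /GRing.scale /= -!opprD lerN2 vx.
      exact/sv/ltW.
  have a0 : 0 <= arch L x by apply: arch_ge0 => //; exact: lt_le_trans LL.
  have a1 : arch L x <= 1 by exact: arch_le1.
  have Ka : 0 <= K * arch L x by rewrite mulr_ge0// ltW.
  have := ler_wpM2r Ka (HL L LL).
  have -> : k / (d2 * K) * (K * arch L x) = k * arch L x / d2.
    by field; rewrite !gt_eqF.
  rewrite ler_pdivlMr// => kv.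
  have := ler_wpM2l (ltW d2_gt0) vxx; rewrite mulr0.
  have ka : k * arch L x <= k by rewrite ler_piMr// ltW.
  have -> : K * (- (pi / 2 / L) ^+ 2 * arch L x) =
      - ((pi / 2 / L) ^+ 2 * (K * arch L x)).
    by ring.
  lra.
Qed.

End solution_comparison.

(** * From mutual bounds to the coexistence state *)
Section asymptotic_bounds.
Variables (R : realType) (w : R -> R -> R).

Lemma limsup_le_mono (A B : R) : A <= B -> limsup_le w A -> limsup_le w B.
Proof.
move=> AB wA L e /(wA L)[T HT]; exists T => t x Tt xL.
by rewrite (le_trans (HT t x Tt xL))// lerD2r.
Qed.

Lemma limsup_le_affine_neg (p q A : R) : 0 < q -> liminf_ge w A ->
  limsup_le (fun t x => p - q * w t x) (p - q * A).
Proof.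
move=> q0 wA L e e0; have [|T HT] := wA L (e / q); first by rewrite divr_gt0.
exists T => t x Tt xL; have := ler_wpM2l (ltW q0) (HT t x Tt xL).
by rewrite mulrBr mulrCA divff ?gt_eqF// mulr1; lra.
Qed.

Lemma liminf_ge_affine_neg (p q A : R) : 0 < q -> limsup_le w A ->
  liminf_ge (fun t x => p - q * w t x) (p - q * A).
Proof.
move=> q0 wA L e e0; have [|T HT] := wA L (e / q); first by rewrite divr_gt0.
exists T => t x Tt xL; have := ler_wpM2l (ltW q0) (HT t x Tt xL).
by rewrite mulrDr mulrCA divff ?gt_eqF// mulr1; lra.
Qed.

Lemma limsup_le_affine (p q A : R) : 0 < q -> limsup_le w A ->
  limsup_le (fun t x => p + q * w t x) (p + q * A).
Proof.
move=> q0 wA L e e0; have [|T HT] := wA L (e / q); first by rewrite divr_gt0.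
exists T => t x Tt xL; have := ler_wpM2l (ltW q0) (HT t x Tt xL).
by rewrite mulrDr mulrCA divff ?gt_eqF// mulr1; lra.
Qed.

Lemma liminf_ge_affine (p q A : R) : 0 < q -> liminf_ge w A ->
  liminf_ge (fun t x => p + q * w t x) (p + q * A).
Proof.
move=> q0 wA L e e0; have [|T HT] := wA L (e / q); first by rewrite divr_gt0.
exists T => t x Tt xL; have := ler_wpM2l (ltW q0) (HT t x Tt xL).
by rewrite mulrBr mulrCA divff ?gt_eqF// mulr1; lra.
Qed.

Lemma liminf_limsup_le (A B : R) : liminf_ge w A -> limsup_le w B -> A <= B.
Proof.
move=> wA wB; apply/ler_addgt0Pr => e e0.
have e20 : 0 < e / 2 by rewrite divr_gt0.
have [T1 H1] := wA 0 _ e20; have [T2 H2] := wB 0 _ e20.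
have [t [T1t T2t _]] := ex_gt3 T1 T2 T2.
have := H1 t 0 T1t; rewrite normr0 lexx => /(_ isT).
have := H2 t 0 T2t; rewrite normr0 lexx => /(_ isT).
lra.
Qed.

(** The infimum m of the admissible bounds A <= A0 is itself a bound; then so is
q + k m, whence m <= q + k m, that is m <= q / (1 - k). *)
Lemma limsup_le_contraction (q k A0 : R) : 0 <= k < 1 -> liminf_ge w 0 ->
  limsup_le w A0 ->
  (forall A, 0 <= A <= A0 -> limsup_le w A -> limsup_le w (q + k * A)) ->
  limsup_le w (q / (1 - k)).
Proof.
move=> /andP[k0 k1] w0 wA0 step.
pose S := [set A | A <= A0 /\ limsup_le w A].
have SA0 : S A0 by [].
have Slb : lbound S 0 by move=> A [_ /(liminf_limsup_le w0)].
have infS : has_inf S by split; [exists A0|exists 0].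
have SA A : S A -> inf S <= A by move=> SA; apply: (ge_inf _ SA); exists 0.
have winf : limsup_le w (inf S).
  move=> L e e0; have e20 : 0 < e / 2 by rewrite divr_gt0.
  have [A [_ wA] AS] := inf_adherent e20 infS.
  have [T HT] := wA L _ e20; exists T => t x Tt xL.
  have := HT t x Tt xL; lra.
have inf0 : 0 <= inf S <= A0.
  by rewrite SA// andbT; apply: lb_le_inf => //; exists A0.
have wn := step _ inf0 winf.
apply: limsup_le_mono winf; rewrite ler_pdivlMr ?subr_gt0//.
have : inf S <= q + k * inf S.
  have [nA0|/ltW A0n] := lerP (q + k * inf S) A0; first exact: SA.
  by move: inf0 => /andP[_ /le_trans]; apply.
lra.
Qed.

End asymptotic_bounds.

Lemma cvg_locally_uniformly_bounds (R : realType) (u v : R -> R -> R) (U V : R) :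
  liminf_ge u U -> limsup_le u U -> liminf_ge v V -> limsup_le v V ->
  cvg_locally_uniformly u v U V.
Proof.
move=> u1 u2 v1 v2 K Kc.
have [M [_ HM]] := compact_bounded Kc.
have KL x : K x -> `|x| <= `|M| + 1.
  move=> Kx; apply: (HM (`|M| + 1)) => //.
  by rewrite (le_lt_trans (ler_norm M))// ltrDl.
move=> P /uniform_nbhs [E [entE EP]].
move: entE; rewrite -entourage_ballE => -[e /= e0 He].
have e20 : 0 < e / 2 by rewrite divr_gt0.
have [T1 H1] := u1 (`|M| + 1) _ e20; have [T2 H2] := u2 (`|M| + 1) _ e20.
have [T3 H3] := v1 (`|M| + 1) _ e20; have [T4 H4] := v2 (`|M| + 1) _ e20.
exists (Num.max (Num.max T1 T2) (Num.max T3 T4)); split; first exact: num_real.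
move=> t; rewrite !gt_max => /andP[/andP[T1t T2t] /andP[T3t T4t]].
apply: EP => x /KL xL; apply: He; split; rewrite /= /ball /= ltr_norml.
  have := H1 t x T1t xL; have := H2 t x T2t xL => *; apply/andP; split; lra.
have := H3 t x T3t xL; have := H4 t x T4t xL => *; apply/andP; split; lra.
Qed.

Lemma FBP_bounds_common (R : realType) (u v : R -> R -> R) (g h : R -> R) :
  FBP_bounds u v g h -> exists2 K : R, 0 < K & forall t x, 0 < t ->
  g t < x < h t -> 0 < u t x <= K /\ 0 < v t x <= K.
Proof.
move=> [k1 [k2 [k3 H]]].
exists (Num.max 1 (Num.max k1 k2)); first by rewrite lt_max ltr01.
move=> t x t0 xin; have [/(_ x xin) [/andP[u0 uk] /andP[v0 vk]] _ _ _] := H t t0.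
by rewrite u0 v0 !le_max uk vk !orbT.
Qed.

Lemma liminf_ge0_logistic (R : realType) (K : R) (r w : R -> R -> R) :
  logistic_comparison K r w -> liminf_ge w 0.
Proof.
move=> lc L e e0; have [T HT] := lc_regular lc L; exists T => t x Tt xL.
have [/andP[w0 _] _] := HT t x Tt xL.
by rewrite sub0r (le_trans _ (ltW w0))// oppr_le0 ltW.
Qed.

(** An upper bound A for u gives the lower bound 1 - c A for v and then the upper
bound a - b + b c A for u; starting from v, an upper bound A gives
1 - a c + b c A.  The restrictions A <= a and A <= 1 keep the intermediate lower
bounds positive. *)
Lemma weak_competition_limit (R : realType) (K a b c : R) (u v : R -> R -> R) :
  0 < K -> 0 < b -> 0 < c -> b < a -> a * c < 1 ->
  logistic_comparison K (fun t x => a - b * v t x) u ->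
  logistic_comparison K (fun t x => 1 - c * u t x) v ->
  cvg_locally_uniformly u v ((a - b) / (1 - b * c)) ((1 - a * c) / (1 - b * c)).
Proof.
move=> K0 b0 c0 ba ac1 ul vl.
have u_ge0 := liminf_ge0_logistic ul; have v_ge0 := liminf_ge0_logistic vl.
have a0 : 0 < a by exact: lt_trans ba.
have bc0 : 0 < b * c by rewrite mulr_gt0.
have bc1 : b * c < 1 by rewrite (lt_trans _ ac1)// ltr_pM2r.
have bck : 0 <= b * c < 1 by rewrite ltW.
have nz : 1 - b * c != 0 by rewrite gt_eqF// subr_gt0.
set U := (a - b) / (1 - b * c); set V := (1 - a * c) / (1 - b * c).
have U0 : 0 < U by rewrite divr_gt0// subr_gt0.
have V0 : 0 < V by rewrite divr_gt0// subr_gt0.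
have UV : a - b * V = U by rewrite /U /V; field.
have VU : 1 - c * U = V by rewrite /U /V; field.
have u_le_a : limsup_le u a.
  apply: (limsup_le_logistic ul K0 (ltW a0)).
  by have := limsup_le_affine_neg a b0 v_ge0; rewrite mulr0 subr0.
have v_le_1 : limsup_le v 1.
  apply: (limsup_le_logistic vl K0 ler01).
  by have := limsup_le_affine_neg 1 c0 u_ge0; rewrite mulr0 subr0.
have u_le : limsup_le u U.
  apply: (limsup_le_contraction bck u_ge0 u_le_a) => A /andP[A0 Aa] uA.
  have cA1 : 0 < 1 - c * A.
    by rewrite subr_gt0 (le_lt_trans _ ac1)// mulrC ler_pM2r.
  have vA := liminf_ge_logistic vl cA1 (liminf_ge_affine_neg 1 c0 uA).
  have uA' := limsup_le_affine_neg a b0 vA.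
  have E : a - b * (1 - c * A) = a - b + b * c * A by ring.
  rewrite E in uA'; apply: (limsup_le_logistic ul K0 _ uA').
  by rewrite addr_ge0 ?subr_ge0 ?(ltW ba)// mulr_ge0// ltW.
have v_le : limsup_le v V.
  apply: (limsup_le_contraction bck v_ge0 v_le_1) => A /andP[A0 A1] vA.
  have bA : 0 < a - b * A.
    by rewrite subr_gt0 (le_lt_trans _ ba)// ler_piMr// ltW.
  have uA := liminf_ge_logistic ul bA (liminf_ge_affine_neg a b0 vA).
  have vA' := limsup_le_affine_neg 1 c0 uA.
  have E : 1 - c * (a - b * A) = 1 - a * c + b * c * A by ring.
  rewrite E in vA'; apply: (limsup_le_logistic vl K0 _ vA').
  by rewrite addr_ge0 ?subr_ge0 ?(ltW ac1)// mulr_ge0// ltW.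
apply: cvg_locally_uniformly_bounds => //.
- apply: (liminf_ge_logistic ul U0).
  by have := liminf_ge_affine_neg a b0 v_le; rewrite UV.
- apply: (liminf_ge_logistic vl V0).
  by have := liminf_ge_affine_neg 1 c0 u_le; rewrite VU.
Qed.

(** An upper bound A <= a for u gives in turn v <= 1 + c A,
u >= a - b (1 + c A), which is positive by the weak predation assumption, a lower
bound for v, and the new upper bound (a - b) (1 - b c) + (b c)^2 A for u. *)
Lemma weak_predation_limit (R : realType) (K a b c : R) (u v : R -> R -> R) :
  0 < K -> 0 < a -> 0 < b -> 0 < c -> b + a * b * c < a ->
  logistic_comparison K (fun t x => a - b * v t x) u ->
  logistic_comparison K (fun t x => 1 + c * u t x) v ->
  cvg_locally_uniformly u v ((a - b) / (1 + b * c)) ((1 + a * c) / (1 + b * c)).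
Proof.
move=> K0 a0 b0 c0 ba ul vl.
have u_ge0 := liminf_ge0_logistic ul; have v_ge0 := liminf_ge0_logistic vl.
have bc0 : 0 < b * c by rewrite mulr_gt0.
have bc1 : b * c < 1.
  rewrite -(ltr_pM2l a0) mulr1 mulrA; have := ba; lra.
have k01 : 0 <= (b * c) ^+ 2 < 1 by rewrite sqr_ge0 expr_lt1// ltW.
have ab : 0 < a - b by have : 0 < a * b * c by [rewrite !mulr_gt0]; lra.
have nz : 1 + b * c != 0 by rewrite gt_eqF// addr_gt0.
have nz' : 1 - b * c != 0 by rewrite gt_eqF// subr_gt0.
set U := (a - b) / (1 + b * c); set V := (1 + a * c) / (1 + b * c).
have U0 : 0 < U by rewrite divr_gt0// addr_gt0.
have V0 : 0 < V by rewrite divr_gt0// addr_gt0// mulr_gt0.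
have UV : a - b * V = U by rewrite /U /V; field.
have VU : 1 + c * U = V by rewrite /U /V; field.
have u_le_a : limsup_le u a.
  apply: (limsup_le_logistic ul K0 (ltW a0)).
  by have := limsup_le_affine_neg a b0 v_ge0; rewrite mulr0 subr0.
have UE : U = (a - b) * (1 - b * c) / (1 - (b * c) ^+ 2).
  have -> : 1 - (b * c) ^+ 2 = (1 - b * c) * (1 + b * c) by ring.
  by rewrite /U; field; rewrite nz nz'.
have u_le : limsup_le u U.
  rewrite UE; apply: (limsup_le_contraction k01 u_ge0 u_le_a) => A /andP[A0 Aa] uA.
  have cA : 0 <= 1 + c * A by rewrite addr_ge0// mulr_ge0// ltW.
  have vA := limsup_le_logistic vl K0 cA (limsup_le_affine 1 c0 uA).
  have u1 : 0 < a - b * (1 + c * A).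
    have : b * c * A <= b * c * a by rewrite ler_pM2l.
    have := ba; lra.
  have uA1 := liminf_ge_logistic ul u1 (liminf_ge_affine_neg a b0 vA).
  have v1 : 0 < 1 + c * (a - b * (1 + c * A)) by rewrite addr_gt0// mulr_gt0.
  have vA1 := liminf_ge_logistic vl v1 (liminf_ge_affine 1 c0 uA1).
  have uA' := limsup_le_affine_neg a b0 vA1.
  have E : a - b * (1 + c * (a - b * (1 + c * A))) =
    (a - b) * (1 - b * c) + (b * c) ^+ 2 * A by ring.
  rewrite E in uA'; apply: (limsup_le_logistic ul K0 _ uA').
  by rewrite addr_ge0 ?mulr_ge0 ?sqr_ge0// ?ltW// subr_gt0.
have v_le : limsup_le v V.
  apply: (limsup_le_logistic vl K0 (ltW V0)).
  by have := limsup_le_affine 1 c0 u_le; rewrite VU.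
have u_ge : liminf_ge u U.
  apply: (liminf_ge_logistic ul U0).
  by have := liminf_ge_affine_neg a b0 v_le; rewrite UV.
apply: cvg_locally_uniformly_bounds => //.
apply: (liminf_ge_logistic vl V0).
by have := liminf_ge_affine 1 c0 u_ge; rewrite VU.
Qed.

Unset Implicit Arguments.

Theorem theorem1p2 (R : realType) (d1 d2 mu rho h0 a b c p : R)
  (J u0 v0 : R -> R)
  (d1_gt0 : 0 < d1) (d2_gt0 : 0 < d2) (mu_gt0 : 0 < mu) (rho_gt0 : 0 < rho)
  (h0_gt0 : 0 < h0) (a_gt0 : 0 < a) (b_gt0 : 0 < b) (c_gt0 : 0 < c)
  (p_gt3 : 3 < p)
  (J_kernel : dispersal_kernel J) (u0v0 : initial_data h0 p u0 v0) :
  (b < a < 1 / c ->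
   forall (u v : R -> R -> R) (g h : R -> R),
     FBP_global_solution d1 d2 mu rho h0 J u0 v0
       (fun u v => u * (a - u - b * v)) (fun u v => v * (1 - v - c * u))
       u v g h ->
     g t @[t --> +oo] --> -oo -> h t @[t --> +oo] --> +oo ->
     cvg_locally_uniformly u v
       ((a - b) / (1 - b * c)) ((1 - a * c) / (1 - b * c)))
  /\
  (b + a * b * c < a ->
   forall (u v : R -> R -> R) (g h : R -> R),
     FBP_global_solution d1 d2 mu rho h0 J u0 v0
       (fun u v => u * (a - u - b * v)) (fun u v => v * (1 - v + c * u))
       u v g h ->
     g t @[t --> +oo] --> -oo -> h t @[t --> +oo] --> +oo ->
     cvg_locally_uniformly u v
       ((a - b) / (1 + b * c)) ((1 + a * c) / (1 + b * c))).

Proof.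
split=> [/andP[ba ac] u v g h [eqs reg bnd] gNy hy|ba u v g h [eqs reg bnd] gNy hy].
  have ac1 : a * c < 1 by rewrite -ltr_pdivlMr.
  have [K K0 bounds] := FBP_bounds_common bnd.
  apply: (weak_competition_limit K0 b_gt0 c_gt0 ba ac1).
    apply: (u_logistic_comparison (r1 := fun V => a - b * V) d1_gt0 J_kernel _ eqs reg
      K0 bounds gNy hy) => U V; ring.
  apply: (v_logistic_comparison (r2 := fun U => 1 - c * U) d2_gt0 _ eqs reg K0
    bounds gNy hy) => U V; ring.
have [K K0 bounds] := FBP_bounds_common bnd.
apply: (weak_predation_limit K0 a_gt0 b_gt0 c_gt0 ba).
  apply: (u_logistic_comparison (r1 := fun V => a - b * V) d1_gt0 J_kernel _ eqs reg K0
    bounds gNy hy) => U V; ring.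
apply: (v_logistic_comparison (r2 := fun U => 1 + c * U) d2_gt0 _ eqs reg K0
  bounds gNy hy) => U V; ring.
Qed.
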